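(* Let $(S,T)$ be a pair of shifted Young tableaux (entries in $X$) such that $T$ extends $S$, and let $\Sigma(S,T)=({}^ST,S_T)$ be its shifted tableau switching. Then: (a) ${}^ST\cup S_T$ has the same shape as $S\cup T$; moreover $S_T$ has the same weight as $S$ and ${}^ST$ has the same weight as $T$; (b) $S_T$ extends ${}^ST$, and $S_T$ and ${}^ST$ are shifted Young tableaux.
   Context: Shifted shapes: for a strict partition $\lambda=(\lambda_1>\cdots>\lambda_\ell>0)$, $S(\lambda)=\{(i,j)\in\mathbb{Z}^2:1\le i\le\ell,\ i\le j\le\lambda_i+i-1\}$ (matrix coordinates); boxes $(i,i)$ form the main diagonal; $\lambda/\mu=S(\lambda)\setminus S(\mu)$ for $\mu\subseteq\lambda$. If $\nu\subseteq\mu\subseteq\lambda$, $\lambda/\mu$ extends $\mu/\nu$; a filling extends another if its shape extends the other's. East/south neighbors of $(i,j)$ are $(i,j+1),(i+1,j)$. Letters $X=\{1'<1<2'<2<\cdots\}$; bold $\mathbf{k}$ means $k$ or $k'$. A shifted Young tableau (SYT) of shape $\lambda/\mu$: filling by $X$ weakly increasing along rows and columns, each column containing at most one unprimed $k$, each row at most one $k'$. Weight: $\mathrm{wt}(T)=(\mathrm{wt}_1(T),\mathrm{wt}_2(T),\ldots)$, $\mathrm{wt}_i(T)$ the number of entries equal to $i$ or $i'$. $T^{(i)}$ is the subfilling of boxes with entry $i$ or $i'$. Switches on a filling whose boxes are labelled as $\mathbf{a}$-boxes (entries $a,a'$) or $\mathbf{b}$-boxes (entries $b,b'$); at an $\mathbf{a}$-box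 $c=(i,j)$ with entry $\alpha$, $E=(i,j+1)$, $S=(i+1,j)$ (entries move with labels): (S3) $j=i$, $E$ a $\mathbf{b}$-box with entry $b'$, $(i+1,i+1)$ a $\mathbf{b}$-box with entry $\beta$: new entries $\beta$ at $(i,i)$, $b$ at $(i,i+1)$ ($\mathbf{b}$-boxes), $\alpha$ at $(i+1,i+1)$. (S4) $j=i+1$, $\alpha=a$, $(i,i)$ an $\mathbf{a}$-box with entry $\alpha_0$, $S=(i+1,i+1)$ a $\mathbf{b}$-box with entry $\beta$, $E$ not a $\mathbf{b}$-box: new entries $\beta$ at $(i,i)$, $a'$ at $(i,i+1)$, $\alpha_0$ at $(i+1,i+1)$. (S7) as (S4) but $E$ a $\mathbf{b}$-box with entry $b$ (unchanged). (S5) $E,S$ both $\mathbf{b}$-boxes, $E$ entry $b'$: interchange $c,E$. (S6) $E,S$ both $\mathbf{b}$-boxes, $E$ entry $b$, not (S7): interchange $c,S$. (S1) only $E$ is a $\mathbf{b}$-box, not (S3): interchange $c,E$. (S2) only $S$ is a $\mathbf{b}$-box, not (S4): interchange $c,S$. A filling is fully switched if no $\mathbf{a}$-box has a $\mathbf{b}$-box as east or south neighbor. Otherwise $\Box(U)$ is the easternmost $\mathbf{a}$-box with entry $a$ having a $\mathbf{b}$-box as east or south neighbor, or if none, the southernmost such $\mathbf{a}$-box with entry $a'$; $\sigma(U)$ applies the applicable switch at $\Box(U)$. The shifted switching process on a pair (an $\mathbf{a}$-part $A$, a $\mathbf{b}$-part $B$ extending it) applies $\sigma$ until fully switched; the resulting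 $\mathbf{a}$-part is $A_B$ and $\mathbf{b}$-part ${}^AB$. Shifted tableau switching of $(S,T)$, $T$ extends $S$: label boxes of $S$ and $T$. Let $m=\max(S)$, $n=\max(T)$ (largest $i$ with positive weight). For $i=m,m-1,\ldots,1$ and, for each $i$, $j=1,2,\ldots,n$: in the current filling apply the shifted switching process to the pair (current $S$-labelled boxes with entries $\mathbf{i}$, current $T$-labelled boxes with entries $\mathbf{j}$), leaving all other boxes unchanged. At the end, $S_T$ is the filling formed by the $S$-labelled boxes and ${}^ST$ by the $T$-labelled boxes; $\Sigma(S,T)=({}^ST,S_T)$. If $S\cup T$ has several connected components, each is treated independently. *)

(* Defs.v *)
From mathcomp Require Import all_boot.
From mathcomp Require Import finmap.

Set Implicit Arguments.
Unset Strict Implicit.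
Unset Printing Implicit Defensive.

Open Scope fset_scope.
Open Scope fmap_scope.

(* Boxes carry matrix coordinates (row, column), numbered from 1. *)
Definition box := (nat * nat)%type.

Definition east (c : box) : box := (c.1, c.2.+1).
Definition south (c : box) : box := (c.1.+1, c.2).

(* (k, true) is the letter k' and (k, false) is the letter k; only k > 0
   belongs to the alphabet X, which [is_SYT] enforces. *)
Definition letter := (nat * bool)%type.

Definition in_X (x : letter) : bool := 0 < x.1.

Definition letter_le (x y : letter) : bool :=
  (x.1 < y.1) || ((x.1 == y.1) && (x.2 || ~~ y.2)).

Definition filling := {fmap box -> letter}.

(** Shifted shapes *)

Definition strict_partition (la : seq nat) : bool :=
  sorted gtn la && (0 \notin la).

Definition shifted_shape (la : seq nat) : pred box :=
  [pred c | (1 <= c.1 <= size la)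
            && (c.1 <= c.2 <= (nth 0 la c.1.-1 + c.1 - 1)%N)].

Definition part_sub (mu la : seq nat) : Prop :=
  {subset shifted_shape mu <= shifted_shape la}.

Definition has_shape (D : {fset box}) (la mu : seq nat) : Prop :=
  D =i [predD shifted_shape la & shifted_shape mu].

Definition is_skew_shape (D : {fset box}) : Prop :=
  exists la mu, [/\ strict_partition la, strict_partition mu,
                    part_sub mu la & has_shape D la mu].

(* The shape of T extends the shape of S. *)
Definition extends (T S : filling) : Prop :=
  exists la mu nu,
    [/\ strict_partition la, strict_partition mu & strict_partition nu] /\
    [/\ part_sub nu mu, part_sub mu la,
        has_shape (domf S) mu nu & has_shape (domf T) la mu].

(** Shifted Young tableaux *)

Definition rows_weakly_increasing (T : filling) : Prop :=
  forall i j j' x y, T.[? (i, j)] = Some x -> T.[? (i, j')] = Some y ->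
    j <= j' -> letter_le x y.

Definition columns_weakly_increasing (T : filling) : Prop :=
  forall i i' j x y, T.[? (i, j)] = Some x -> T.[? (i', j)] = Some y ->
    i <= i' -> letter_le x y.

Definition columns_unprimed_once (T : filling) : Prop :=
  forall k i i' j, T.[? (i, j)] = Some (k, false) ->
    T.[? (i', j)] = Some (k, false) -> i = i'.

Definition rows_primed_once (T : filling) : Prop :=
  forall k i j j', T.[? (i, j)] = Some (k, true) ->
    T.[? (i, j')] = Some (k, true) -> j = j'.

Definition is_SYT (T : filling) : Prop :=
  is_skew_shape (domf T) /\
  (forall c x, T.[? c] = Some x -> in_X x) /\
  [/\ rows_weakly_increasing T, columns_weakly_increasing T,
      columns_unprimed_once T & rows_primed_once T].

Definition wt (T : filling) (k : nat) : nat :=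
  #|[set c : domf T | (T c).1 == k]|.

Definition max_entry (T : filling) : nat := \max_(c : domf T) (T c).1.

(** Switches *)

Inductive label := LabS | LabT.

Definition labelled := {fmap box -> label * letter}.

(* When switching i against j, the a-boxes are the S-labelled boxes with entry
   i or i', and the b-boxes are the T-labelled boxes with entry j or j'. *)
Definition abox (a : nat) (U : labelled) (c : box) : bool :=
  if U.[? c] is Some (LabS, x) then x.1 == a else false.

Definition bbox (b : nat) (U : labelled) (c : box) : bool :=
  if U.[? c] is Some (LabT, x) then x.1 == b else false.

Definition primed (U : labelled) (c : box) : bool :=
  if U.[? c] is Some (_, x) then x.2 else false.

Definition exchange (U : labelled) (c d : box) : labelled :=
  if (U.[? c], U.[? d]) is (Some x, Some y) then U.[c <- y].[d <- x] else U.

(* In the four definitions below, (i, j) is assumed to be an a-box. *)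
Definition is_S3 (b : nat) (U : labelled) (c : box) : bool :=
  let: (i, j) := c in
  [&& j == i, bbox b U (east c), primed U (east c) & bbox b U (i.+1, i.+1)].

Definition corner_S4_S7 (a b : nat) (U : labelled) (c : box) : bool :=
  let: (i, j) := c in
  [&& j == i.+1, ~~ primed U c, abox a U (i, i) & bbox b U (south c)].

Definition is_S4 (a b : nat) (U : labelled) (c : box) : bool :=
  corner_S4_S7 a b U c && ~~ bbox b U (east c).

Definition is_S7 (a b : nat) (U : labelled) (c : box) : bool :=
  [&& corner_S4_S7 a b U c, bbox b U (east c) & ~~ primed U (east c)].

Definition apply_S3 (b : nat) (U : labelled) (c : box) : labelled :=
  let: (i, _) := c in
  if (U.[? c], U.[? (i.+1, i.+1)]) is (Some alpha, Some beta) then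
    U.[c <- beta].[east c <- (LabT, (b, false))].[(i.+1, i.+1) <- alpha]
  else U.

Definition apply_S4_S7 (a : nat) (U : labelled) (c : box) : labelled :=
  let: (i, _) := c in
  if (U.[? (i, i)], U.[? south c]) is (Some alpha0, Some beta) then
    U.[(i, i) <- beta].[c <- (LabS, (a, true))].[south c <- alpha0]
  else U.

Definition switch (a b : nat) (U : labelled) (c : box) : labelled :=
  let bE := bbox b U (east c) in
  let bS := bbox b U (south c) in
  if is_S3 b U c then apply_S3 b U c
  else if is_S4 a b U c || is_S7 a b U c then apply_S4_S7 a U c
  else if [&& bE, bS & primed U (east c)] then exchange U c (east c)   (* S5 *)
  else if bE && bS then exchange U c (south c)                         (* S6 *)
  else if bE then exchange U c (east c)                                (* S1 *)
  else if bS then exchange U c (south c)                               (* S2 *)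
  else U.

(** The shifted switching process *)

Definition switchable (a b : nat) (U : labelled) (c : box) : bool :=
  abox a U c && (bbox b U (east c) || bbox b U (south c)).

Definition fully_switched (a b : nat) (U : labelled) : Prop :=
  forall c, ~~ switchable a b U c.

(* c is the easternmost switchable box with entry a, or, if there is none, the
   southernmost switchable box with entry a'.  Nothing here forces such a box
   to be unique, so the process below is a relation covering every choice. *)
Definition is_next_box (a b : nat) (U : labelled) (c : box) : Prop :=
  switchable a b U c /\
  forall d, switchable a b U d ->
    if primed U c then primed U d /\ d.1 <= c.1
    else ~~ primed U d -> d.2 <= c.2.

Inductive switching_process (a b : nat) : labelled -> labelled -> Prop :=
| process_done U :
    fully_switched a b U -> switching_process a b U U
| process_step U c V :
    is_next_box a b U c -> switching_process a b (switch a b U c) V ->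
    switching_process a b U V.

(** Shifted tableau switching *)

Fixpoint switching_sequence (ps : seq (nat * nat)) (U V : labelled) : Prop :=
  if ps is p :: ps' then
    exists2 W, switching_process p.1 p.2 U W & switching_sequence ps' W V
  else V = U.

Definition switching_order (m n : nat) : seq (nat * nat) :=
  [seq (i, j) | i <- rev (iota 1 m), j <- iota 1 n].

Definition label_boxes (S T : filling) : labelled :=
  [fmap c : domf S => (LabS, S c)] + [fmap c : domf T => (LabT, T c)].

Definition S_part (U : labelled) : filling :=
  reducef [fmap c : domf U => if U c is (LabS, x) then Some x else None].

Definition T_part (U : labelled) : filling :=
  reducef [fmap c : domf U => if U c is (LabT, x) then Some x else None].

(* [R.1] is the T-labelled part and [R.2] the S-labelled part of the result. *)
Definition component_switching (S T : filling) (R : filling * filling) : Prop :=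
  exists2 U,
    switching_sequence (switching_order (max_entry S) (max_entry T))
      (label_boxes S T) U
    & R = (T_part U, S_part U).

Definition adjacent (D : {fset box}) : rel D := fun c d =>
  let nbr (x y : box) := (y == east x) || (y == south x) in
  nbr (val c) (val d) || nbr (val d) (val c).

Definition component (D : {fset box}) (c : D) : {fset box} :=
  [fset val d | d : D & connect (@adjacent D) c d].

Definition components (D : {fset box}) : {fset {fset box}} :=
  [fset component c | c : D].

Definition is_union (Cs : {fset {fset box}}) (F : {fset box} -> filling)
    (T : filling) : Prop :=
  forall c x, T.[? c] = Some x <-> exists2 C, C \in Cs & (F C).[? c] = Some x.

(* [tableau_switching S T (T', S')] states that Sigma(S, T) = (T', S'): each
   connected component of the union of S and T is switched on its own. *)
Definition tableau_switching (S T : filling) (R : filling * filling) : Prop :=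
  let Cs := components (domf S `|` domf T) in
  exists F : {fset box} -> filling * filling,
    (forall C, C \in Cs -> component_switching S.[& C] T.[& C] (F C)) /\
    is_union Cs (fun C => (F C).1) R.1 /\
    is_union Cs (fun C => (F C).2) R.2.

(* Main.v *)
Require Import Defs.
From mathcomp Require Import all_boot.
From mathcomp Require Import finmap.
From Stdlib Require Import Lia FunctionalExtensionality.

(* Fix a letter of S, whose boxes are the a-boxes, and the letter of T that is
   switched with it, whose boxes are the b-boxes.  During the process each of the
   two parts stays perforated: weakly increasing for the north-west order on
   boxes, with one unprimed letter per column, one primed letter per row and one
   box on the diagonal.  Perforated pairs alone are not stable under switches;
   what makes the induction work is that only the box about to move can have
   b-boxes both north-west and south-east of it, together with two conditions on
   the north-east corner of two a-boxes with the same letter.  A switch moves the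
   a-part south-east, so the process ends, and at the end no b-box is south-east
   of an a-box.
     With several letters, the classes of boxes sharing label and letter are nested
   like a chain of shapes, and each process exchanges two consecutive classes.
   Two boxes that are comparable for the north-west order lie in the same
   connected component, so the components can be treated one at a time. *)

(** In the middle of a process the a-boxes and the b-boxes may be interleaved, so the two parts need
    not have skew shapes and [extends] is of no use; only their union keeps its shape. Shapes are
    therefore replaced by convex sets of boxes, a notion that suits a union of two consecutive
    classes as well as a component, and partitions are rebuilt only at the end. The rules of
    switching are dictated by the invariant. Where both neighbors are b-boxes, the rejected exchange
    would break a clause of [perforated]; (S3), (S4) and (S7) replace exchanges that would put two
    boxes of one part on the diagonal, and the prime they alter is forced by the new neighbors.
    After a switch, only the a-box just moved (for (S4) and (S7), the new a' beside the diagonal)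
    can be straddled, and if it is, it is the next one to move. *)

Set Implicit Arguments.
Unset Strict Implicit.
Unset Printing Implicit Defensive.

(** * Two letters: perforated fillings *)

Open Scope coq_nat_scope.

(* [f i j = Some (LabS, p)] when box (i, j) is an a-box, primed if [p] holds;
   [LabT] marks the b-boxes, and all other boxes are ignored. *)
Definition cells := nat -> nat -> option (label * bool).

Notation Acell s := (Some (LabS, s)).
Notation Bcell s := (Some (LabT, s)).

(* The pair formed by the a-part and the b-part of [f].  The last two fields, about
   a box of the row or column through the north-east corner of two a-boxes, are
   what prevents a switch from creating two equal letters in a column or row. *)
Record perforated (f : cells) : Prop := Perforated {
  perf_plane : forall i j x, f i j = Some x -> i <= j;
  perf_convex : forall i j k l u v x y, f i j = Some x -> f k l = Some y ->
    i <= u -> u <= k -> j <= v -> v <= l -> u <= v -> exists l0 s, f u v = Some (l0, s);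
  perf_ord : forall l0 i j k l, f i j = Some (l0, false) ->
    f k l = Some (l0, true) -> i <= k -> j <= l -> False;
  perf_col : forall l0 i j k, f i j = Some (l0, false) ->
    f k j = Some (l0, false) -> i < k -> False;
  perf_row : forall l0 i j k, f i j = Some (l0, true) ->
    f i k = Some (l0, true) -> j < k -> False;
  perf_diag : forall l0 i j s t, f i i = Some (l0, s) -> f j j = Some (l0, t) ->
    i < j -> False;
  perf_unprimed_corner : forall i j k l r, f i j = Acell false -> f k l = Acell false ->
    f r l = Bcell true -> i <= r -> r < k -> j < l -> False;
  perf_primed_corner : forall i j k l r, f i j = Acell true -> f k l = Acell true ->
    f i r = Bcell false -> i < k -> j < r -> r <= l -> False
}.

Definition switchable_cell (f : cells) i j s :=
  f i j = Acell s /\ exists t, f i j.+1 = Bcell t \/ f i.+1 j = Bcell t.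

Definition next_cell (f : cells) i j s :=
  switchable_cell f i j s /\
  forall u v r, switchable_cell f u v r ->
    if s then r = true /\ u <= i else r = false -> v <= j.

Definition straddled (f : cells) i j := exists u v u' v' t t',
  [/\ f u v = Bcell t, f u' v' = Bcell t', u <= i /\ i <= u' & v <= j /\ j <= v'].

(* An a-box that is straddled by b-boxes is in the course of being moved. *)
Record switching_inv (f : cells) : Prop := Inv {
  inv_perforated : perforated f;
  inv_straddled : forall i j s, f i j = Acell s -> straddled f i j -> next_cell f i j s
}.

Definition upd (f : cells) i j x : cells :=
  fun u v => if (u == i) && (v == j) then x else f u v.

Lemma upd_eq f i j x : upd f i j x i j = x.
Proof. by rewrite /upd !eqxx. Qed.

Lemma upd_neq f i j x u v : u <> i \/ v <> j -> upd f i j x u v = f u v.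
Proof. by move=> H; rewrite /upd; case: eqP => // e1; case: eqP => // e2; case: H. Qed.

Lemma updP f i j x u v y : upd f i j x u v = y ->
  (u = i /\ v = j /\ x = y) \/ ((u <> i \/ v <> j) /\ f u v = y).
Proof.
rewrite /upd; case: eqP => [->|nu]; last by right; split; [left|].
by case: eqP => [->|nv]; [left | right; split; [right|]].
Qed.

(** By [perf_convex] a monotone path from the a-box to the b-box stays in the shape, and its last
    a-box before the first b-box is switchable. This turns the local notions of next box and of
    fully switched filling into statements about all boxes to the south-east. *)
Lemma exit_cell f x y s u v t : perforated f -> f x y = Acell s -> f u v = Bcell t ->
  x <= u -> y <= v -> exists z w r,
  [/\ x <= z /\ z <= u, y <= w /\ w <= v & switchable_cell f z w r].
Proof.
move=> bf; move en : (Nat.add (Nat.sub u x) (Nat.sub v y)) => n.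
elim: n x y s en => [|n IH] x y s en fx fu le_x le_y.
  have [e1 e2] : x = u /\ y = v by lia.
  by move: fx; rewrite e1 e2 fu.
have [a [b [ha [h1 h2] h3]]] : exists a b, [/\ (a = x /\ b = y.+1) \/ (a = x.+1 /\ b = y),
    (x <= a /\ a <= u) /\ (y <= b /\ b <= v) & a <= b].
  have := perf_plane bf fx; have := perf_plane bf fu.
  (* Going east first keeps the path on or above the diagonal: a step south occurs only in column v,
     where x.+1 <= u <= v. *)
  have [?|?] : y < v \/ v <= y by lia.
    by exists x, y.+1; split; lia.
  by exists x.+1, y; split; lia.
have [l0 [s' fa]] : exists l0 s', f a b = Some (l0, s').
  by apply: (perf_convex bf fx fu) => //; lia.
case: l0 fa => fa.
  have [|||z [w [r [? ? ?]]]] := IH a b s' _ fa fu; try lia.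
  by exists z, w, r; split => //; lia.
exists x, y, s; split; try lia; split => //; exists s'.
by case: ha fa => -[-> ->] ->; [left | right].
Qed.

Section Mover.

Variables (f : cells) (i j : nat) (s : bool).
Hypothesis finv : switching_inv f.
Hypothesis fnext : next_cell f i j s.

Let bf := inv_perforated finv.

Lemma mover_cell : f i j = Acell s.
Proof. by case: fnext => -[]. Qed.

(** The switchable box given by [exit_cell] is unprimed by [perf_ord], hence a competitor of the
    next box, which is the easternmost one. *)
Lemma next_unprimed x y u v t : s = false -> f x y = Acell false ->
  f u v = Bcell t -> x <= u -> y <= v -> y <= j.
Proof.
move=> sF fx fu le_x le_y; have [z [w [r [hz hw hs]]]] := exit_cell bf fx fu le_x le_y.
have [_ /(_ _ _ _ hs)] := fnext; rewrite sF => H.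
case: r hs H => hs H; last by move/(_ erefl): H; lia.
by have [fz _] := hs; case: (perf_ord bf fx fz); lia.
Qed.

Lemma next_primed x y r u v t : s = true -> f x y = Acell r ->
  f u v = Bcell t -> x <= u -> y <= v -> r = true /\ x <= i.
Proof.
move=> sT fx fu le_x le_y; have [z [w [r' [hz hw hs]]]] := exit_cell bf fx fu le_x le_y.
have [_ /(_ _ _ _ hs)] := fnext; rewrite sT => -[r'T le_z]; split; last by lia.
case: r fx => // fx; have [fz _] := hs; rewrite r'T in fz.
by case: (perf_ord bf fx fz); lia.
Qed.

(** Two next boxes agree in their prime and in their column (their row, if primed), so [perf_col] or
    [perf_row] identifies them. In particular at most one a-box is straddled. *)
Lemma next_unique x y r u v t u' v' t' : f x y = Acell r ->
  f u v = Bcell t -> f u' v' = Bcell t' ->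
  u <= x -> x <= u' -> v <= y -> y <= v' -> x = i /\ y = j.
Proof.
move=> fx fu fv h1 h2 h3 h4.
have nx : next_cell f x y r.
  by apply: (inv_straddled finv) => //; exists u, v, u', v', t, t'; split.
have fc := mover_cell.
case: nx => sx nx; case: fnext => sc nc.
move: (nx _ _ _ sc) (nc _ _ _ sx) => {nx nc}.
case: r fx sx => fx sx; case: s fc sc => fc sc //=.
- move=> [_ ?] [_ ?]; have e : x = i by lia.
  split => //; subst x; have [?|[?|//]] : y < j \/ j < y \/ y = j by lia.
    by case: (perf_row bf fx fc).
  by case: (perf_row bf fc fx).
- by case.
- by move=> ? [].
- move=> /(_ erefl) ? /(_ erefl) ?; have e : y = j by lia.
  split => //; subst y; have [?|[?|//]] : x < i \/ i < x \/ x = i by lia.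
    by case: (perf_col bf fx fc).
  by case: (perf_col bf fc fx).
Qed.

End Mover.

Section Absurd.

Variable f : cells.
Hypothesis bf : perforated f.

(** Here and below the arithmetic is gathered in one conjunction, and coordinates that must agree
    are tied by an equation, so that [contra_with] selects hypotheses by the contents of their boxes
    and leaves the coordinates to [lia]. *)
Lemma absurd_ord l0 i j k l : f i j = Some (l0, false) ->
    f k l = Some (l0, true) -> i <= k /\ j <= l -> False.
Proof. by move=> h1 h2 [h3 h4]; apply: (perf_ord bf h1 h2). Qed.

Lemma absurd_col l0 i j k l : f i j = Some (l0, false) ->
    f k l = Some (l0, false) -> j = l /\ i <> k -> False.
Proof.
move=> h1 h2 [h3 h4]; subst l; have [?|?] : i < k \/ k < i by lia.
  exact: (perf_col bf h1 h2).
exact: (perf_col bf h2 h1).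
Qed.

Lemma absurd_row l0 i j k l : f i j = Some (l0, true) ->
    f k l = Some (l0, true) -> i = k /\ j <> l -> False.
Proof.
move=> h1 h2 [h3 h4]; subst k; have [?|?] : j < l \/ l < j by lia.
  exact: (perf_row bf h1 h2).
exact: (perf_row bf h2 h1).
Qed.

Lemma absurd_diag l0 s t i j k l : f i j = Some (l0, s) ->
    f k l = Some (l0, t) -> i = j /\ k = l /\ i <> k -> False.
Proof.
move=> h1 h2 [h3 [h4 h5]]; subst j l; have [?|?] : i < k \/ k < i by lia.
  exact: (perf_diag bf h1 h2).
exact: (perf_diag bf h2 h1).
Qed.

Lemma absurd_eq x y i j k l : f i j = Some x -> f k l = Some y ->
  x <> y -> i = k /\ j = l -> False.
Proof. by move=> h1 h2 h [e1 e2]; subst k l; apply: h; move: h1; rewrite h2 => -[]. Qed.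

Lemma absurd_unprimed_corner i j k l r l' : f i j = Acell false -> f k l = Acell false ->
    f r l' = Bcell true -> i <= r /\ r < k /\ j < l /\ l = l' -> False.
Proof. by move=> h1 h2 h3 [h4 [h5 [h6 h7]]]; subst l'; apply: (perf_unprimed_corner bf h1 h2 h3). Qed.

Lemma absurd_primed_corner i j k l r i' : f i j = Acell true -> f k l = Acell true ->
    f i' r = Bcell false -> i < k /\ j < r /\ r <= l /\ i = i' -> False.
Proof. by move=> h1 h2 h3 [h4 [h5 [h6 h7]]]; subst i'; apply: (perf_primed_corner bf h1 h2 h3). Qed.

End Absurd.

Section AbsurdNext.

Variable f : cells.
Hypothesis finv : switching_inv f.

Lemma absurd_next0 i j x y u v t : next_cell f i j false -> f x y = Acell false ->
  f u v = Bcell t -> x <= u /\ y <= v /\ j < y -> False.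
Proof.
by move=> n h1 h2 [h3 [h4 h5]]; have := next_unprimed finv n erefl h1 h2 h3 h4; lia.
Qed.

Lemma absurd_next1 i j x y u v t : next_cell f i j true -> f x y = Acell false ->
  f u v = Bcell t -> x <= u /\ y <= v -> False.
Proof. by move=> n h1 h2 [h3 h4]; have := next_primed finv n erefl h1 h2 h3 h4; case. Qed.

Lemma absurd_next1' i j x y u v r t : next_cell f i j true -> f x y = Acell r ->
  f u v = Bcell t -> x <= u /\ y <= v /\ i < x -> False.
Proof.
by move=> n h1 h2 [h3 [h4 h5]]; have := next_primed finv n erefl h1 h2 h3 h4; lia.
Qed.

Lemma absurd_unique i j s x y r u v t u' v' t' : next_cell f i j s -> f x y = Acell r ->
  f u v = Bcell t -> f u' v' = Bcell t' ->
  u <= x /\ x <= u' /\ v <= y /\ y <= v' -> x <> i \/ y <> j -> False.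
Proof.
by move=> n h1 h2 h3 [h4 [h5 [h6 h7]]]; have := next_unique finv n h1 h2 h3 h4 h5 h6 h7; lia.
Qed.

End AbsurdNext.

(* [lia] is exponential in the number of disequalities, which record that a box
   is not one of those that moved; most contradictions do not need them. *)
Ltac light_lia := repeat match goal with D : _ \/ _ |- _ => clear D end; lia.

(** The branch with [Hn] catches hypotheses that exclude a configuration, such as [fS], [nS3] or
    [noA] below, which are stated in this form for that purpose. *)
Ltac contra_with finv fnext solver :=
  let bf := constr:(inv_perforated finv) in
  match goal with
  | H1 : _ = Some (?l, false), H2 : _ = Some (?l, true) |- _ =>
      exfalso; apply: (absurd_ord bf H1 H2); solver ()
  | H1 : _ = Some (?l, false), H2 : _ = Some (?l, false) |- _ =>
      exfalso; apply: (absurd_col bf H1 H2); solver ()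
  | H1 : _ = Some (?l, true), H2 : _ = Some (?l, true) |- _ =>
      exfalso; apply: (absurd_row bf H1 H2); solver ()
  | H1 : _ = Some (?l, _), H2 : _ = Some (?l, _) |- _ =>
      exfalso; apply: (absurd_diag bf H1 H2); solver ()
  | H1 : _ = Some ?x, H2 : _ = Some ?y |- _ =>
      exfalso; apply: (absurd_eq H1 H2); [discriminate | solver ()]
  | H1 : _ = Some _, Hn : forall x y t, _ -> _ -> False |- _ =>
      exfalso; apply: (Hn _ _ _ H1); solver ()
  | H1 : _ = Acell false, H2 : _ = Bcell _ |- _ =>
      exfalso; apply: (absurd_next0 finv fnext H1 H2); solver ()
  | H1 : _ = Acell false, H2 : _ = Bcell _ |- _ =>
      exfalso; apply: (absurd_next1 finv fnext H1 H2); solver ()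
  | H1 : _ = Acell _, H2 : _ = Bcell _ |- _ =>
      exfalso; apply: (absurd_next1' finv fnext H1 H2); solver ()
  | H1 : _ = Acell false, H2 : _ = Acell false, H3 : _ = Bcell true |- _ =>
      exfalso; apply: (absurd_unprimed_corner bf H1 H2 H3); solver ()
  | H1 : _ = Acell true, H2 : _ = Acell true, H3 : _ = Bcell false |- _ =>
      exfalso; apply: (absurd_primed_corner bf H1 H2 H3); solver ()
  | H1 : _ = Acell _, H2 : _ = Bcell _, H3 : _ = Bcell _ |- _ =>
      exfalso; apply: (absurd_unique finv fnext H1 H2 H3); [solver () | first [assumption | solver ()]]
  end.

Ltac contra finv fnext :=
  first [ contra_with finv fnext ltac:(fun _ => light_lia)
        | contra_with finv fnext ltac:(fun _ => lia) ].

Ltac planes bf :=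
  repeat match goal with
  | H : _ ?x ?y = Some _ |- _ =>
     lazymatch goal with
     | _ : le x y |- _ => fail
     | _ => have ? := perf_plane bf H
     end
  end.

(** Convexity puts (x, y) in the shape; its four possible contents become four goals. *)
Ltac cell_with finv x y solver :=
  let l0 := fresh "l0" in let s0 := fresh "s0" in let H := fresh "cell" in
  match goal with
  | H1 : _ = Some _, H2 : _ = Some _ |- _ =>
     have [l0 [s0 H]] := perf_convex (inv_perforated finv) (u := x) (v := y) H1 H2
        ltac:(solver ()) ltac:(solver ()) ltac:(solver ()) ltac:(solver ()) ltac:(solver ())
  end; destruct l0, s0.

Ltac cell finv x y :=
  first [ cell_with finv x y ltac:(fun _ => light_lia)
        | cell_with finv x y ltac:(fun _ => lia) ].

Ltac hint finv fnext x y := solve [cell finv x y; contra finv fnext].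

(* Most contradictions need one more box of the shape, in the row of a known box
   and the column of another. *)
Ltac search finv fnext :=
  match goal with
  | H : _ ?x _ = Some _, H' : _ _ ?y = Some _ |- _ => hint finv fnext x y
  end.

Ltac bools := repeat match goal with b : bool |- _ => destruct b end;
  repeat match goal with
  | H : true = true -> _ |- _ => specialize (H erefl)
  | H : false = false -> _ |- _ => specialize (H erefl)
  | H : true = false -> _ |- _ => clear H
  | H : false = true -> _ |- _ => clear H
  end.

Ltac inj := repeat match goal with
  | H : Some _ = Some _ |- _ => injection H; clear H; intros; subst
  end.

Ltac start finv split_upd := intros; split_upd; subst; try congruence;
  inj; try congruence; planes (inv_perforated finv).

(** The boxes next to the mover are tried first because [search] runs through all pairs of a known
    row and a known column. *)
Ltac simple_close finv fnext :=
  lazymatch type of fnext with next_cell _ ?i ?j _ =>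
    first [ contra finv fnext | hint finv fnext i.+1 j
      | hint finv fnext i.+1 j.+1 | hint finv fnext i j.+1
      | hint finv fnext i.+1 i.+1 | hint finv fnext i i | search finv fnext ]
  end.

Ltac close finv fnext :=
  lazymatch type of fnext with next_cell _ ?i ?j _ =>
    first [ simple_close finv fnext
      | solve [(have [?|?] : i < j \/ i = j by lia); [|subst]; simple_close finv fnext]
      | solve [(have [?|?] : i.+1 = j \/ i.+1 <> j by lia); simple_close finv fnext] ]
  end.

Ltac finish finv fnext :=
  first [ light_lia | contra_with finv fnext ltac:(fun _ => light_lia)
        | bools; close finv fnext ].

(** The condition on coordinate sums covers the east and the south neighbor without a case split,
    and every obligation ends in [False], as [finish] expects. *)
Lemma next_cellI g i j s : switchable_cell g i j s ->
  (forall u v u' v' t, s = false -> g u v = Acell false -> g u' v' = Bcell t ->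
    u <= u' -> v <= v' -> Nat.add u' v' = (Nat.add u v).+1 -> j < v -> False) ->
  (forall u v u' v' t, s = true -> g u v = Acell false -> g u' v' = Bcell t ->
    u <= u' -> v <= v' -> Nat.add u' v' = (Nat.add u v).+1 -> False) ->
  (forall u v u' v' t, s = true -> g u v = Acell true -> g u' v' = Bcell t ->
    u <= u' -> v <= v' -> Nat.add u' v' = (Nat.add u v).+1 -> i < u -> False) ->
  next_cell g i j s.
Proof.
move=> gs H0 H1 H2; split=> // u v r [guv [t gt]].
have [u' [v' [gt' [le1 [le2 adj]]]]] : exists u' v', g u' v' = Bcell t /\
    (u <= u' /\ v <= v' /\ Nat.add u' v' = (Nat.add u v).+1).
  by case: gt => gt; [exists u, v.+1 | exists u.+1, v]; split=> //; lia.
case: s {gs} H0 H1 H2 => H0 H1 H2; last first.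
  move=> rF; rewrite rF in guv; have [//|?] : v <= j \/ j < v by lia.
  by case: (H0 _ _ _ _ _ erefl guv gt' le1 le2 adj).
case: r guv => guv; last by case: (H1 _ _ _ _ _ erefl guv gt' le1 le2 adj).
split=> //; have [//|?] : u <= i \/ i < u by lia.
by case: (H2 _ _ _ _ _ erefl guv gt' le1 le2 adj).
Qed.

Section EqDom.

Variables (f g : cells).
Hypothesis bf : perforated f.
Hypothesis dom : forall u v, isSome (g u v) = isSome (f u v).

(** Switches rewrite only occupied boxes, so the clauses of [perforated] about the shape alone carry
    over. *)
Lemma plane_eqdom i j x : g i j = Some x -> i <= j.
Proof.
by have := dom i j; case: (g i j) => // y; case fij: (f i j) => [z|] // _ _; apply: perf_plane fij.
Qed.

Lemma convex_eqdom i j k l u v x y : g i j = Some x -> g k l = Some y ->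
    i <= u -> u <= k -> j <= v -> v <= l -> u <= v -> exists l0 s, g u v = Some (l0, s).
Proof.
have := dom i j; case: (g i j) => // ?; case fij: (f i j) => [z|] // _ _.
have := dom k l; case: (g k l) => // ?; case fkl: (f k l) => [z'|] // _ _ h1 h2 h3 h4 h5.
have [l0 [s fuv]] := perf_convex bf fij fkl h1 h2 h3 h4 h5.
by have := dom u v; rewrite fuv; case: (g u v) => // -[a b] _; exists a, b.
Qed.

End EqDom.

(** * The four kinds of moves preserve the invariant *)

Definition move_east (f : cells) i j s e :=
  upd (upd f i j (Bcell e)) i j.+1 (Acell s).

Lemma move_eastP f i j s e u v y : move_east f i j s e u v = y ->
  [\/ [/\ u = i, v = j & y = Bcell e], [/\ u = i, v = j.+1 & y = Acell s] |
      [/\ u <> i \/ v <> j, u <> i \/ v <> j.+1 & f u v = y]].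
Proof.
case/updP => [[? [? ?]]|[h /updP]]; first by constructor 2.
by case=> [[? [? ?]]|[h' ?]]; [constructor 1 | constructor 3].
Qed.

Ltac split_east :=
  repeat match goal with
  | H : move_east _ _ _ _ _ _ _ = _ |- _ => case/move_eastP: H => [[? ? ?]|[? ? ?]|[? ? H]]
  end.

(** [fS] excludes the case of (S6), where an unprimed b arriving at (i, j) would have a b-box just
    below it; [nS3] excludes that of (S3), where two b-boxes would stand on the diagonal. *)
Lemma move_east_perforated f i j s e (finv : switching_inv f) (fnext : next_cell f i j s)
  (fE : f i j.+1 = Bcell e)
  (fS : e = false -> forall x y t, f x y = Bcell t -> x = i.+1 /\ y = j -> False)
  (nS3 : e = true -> forall x y t, f x y = Bcell t ->
     i = j /\ x = i.+1 /\ y = i.+1 -> False) :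
  perforated (move_east f i j s e).
Proof.
have fc := mover_cell fnext.
have dom u v : isSome (move_east f i j s e u v) = isSome (f u v).
  rewrite /move_east /upd; case: andP => [[/eqP -> /eqP ->]|_]; first by rewrite fE.
  by case: andP => [[/eqP -> /eqP ->]|_] //; rewrite fc.
split.
- exact: plane_eqdom (inv_perforated finv) dom.
- exact: convex_eqdom (inv_perforated finv) dom.
{ move=> l0 i0 j0 k l ? ? ? ?; (have [?|?] : j < j0 \/ j0 <= j by lia);
  (have [?|?] : j < l \/ l <= j by lia).
  all: start finv split_east; finish finv fnext. }
1-5: start finv split_east; finish finv fnext.
Qed.

(** Only the b-box arriving at (i, j) could make another a-box straddled. Such an a-box was
    straddled already, thanks to (i, j.+1), or lies below (i, j) in column j, where [perf_ord],
    [perf_col] or the choice of the mover forbids it. *)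
Lemma move_east_straddled f i j s e (finv : switching_inv f) (fnext : next_cell f i j s)
  (fE : f i j.+1 = Bcell e) x y r :
  move_east f i j s e x y = Acell r -> straddled (move_east f i j s e) x y ->
  next_cell (move_east f i j s e) x y r.
Proof.
have fc := mover_cell fnext => fx [u [v [u' [v' [t [t' [fu fu' [h1 h1'] [h2 h2']]]]]]]].
have [ex ey] : x = i /\ y = j.+1.
  have [?|?] : j < y \/ y <= j by lia.
    by start finv split_east; finish finv fnext.
  by start finv split_east; finish finv fnext.
subst x y; have {fx} er : r = s by start finv split_east; lia.
subst r; apply: next_cellI.
  split; first by rewrite /move_east upd_eq.
  (* An a-box at (i, j.+2), or in the second case at (i.+1, j.+1), would have been straddled before
     the move; so that place holds a b-box and the mover can go on. *)
  have [lt_v|le_v] : j.+1 < v' \/ v' <= j.+1 by lia.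
    have [t0 ft0] : exists t0, f i j.+2 = Bcell t0.
      start finv split_east; try light_lia; cell finv i j.+2;
        try contra finv fnext; try (by eexists; eassumption).
    by exists t0; left; rewrite /move_east !upd_neq //; right; lia.
  have [t0 ft0] : exists t0, f i.+1 j.+1 = Bcell t0.
    start finv split_east; try light_lia; cell finv i.+1 j.+1;
        try contra finv fnext; try (by eexists; eassumption).
  by exists t0; right; rewrite /move_east !upd_neq //; left; lia.
all: clear fu fu' h1 h2 h1' h2'; start finv split_east; finish finv fnext.
Qed.

Definition move_south (f : cells) i j s e :=
  upd (upd f i j (Bcell e)) i.+1 j (Acell s).

Lemma move_southP f i j s e u v y : move_south f i j s e u v = y ->
  [\/ [/\ u = i, v = j & y = Bcell e], [/\ u = i.+1, v = j & y = Acell s] |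
      [/\ u <> i \/ v <> j, u <> i.+1 \/ v <> j & f u v = y]].
Proof.
case/updP => [[? [? ?]]|[h /updP]]; first by constructor 2.
by case=> [[? [? ?]]|[h' ?]]; [constructor 1 | constructor 3].
Qed.

Ltac split_south :=
  repeat match goal with
  | H : move_south _ _ _ _ _ _ _ = _ |- _ => case/move_southP: H => [[? ? ?]|[? ? ?]|[? ? H]]
  end.

(** For the diagonal clause, when the mover reaches (i.+1, i.+1) while another a-box lies further
    down the diagonal: the boxes of column i.+2 in rows i to i.+2 give the contradiction. *)
Ltac deep finv fnext :=
  lazymatch type of fnext with next_cell _ ?i _ _ =>
    solve [cell finv i.+2 i.+2; try contra finv fnext; cell finv i.+1 i.+2;
      try contra finv fnext; cell finv i i.+2; contra finv fnext]
  end.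

Ltac deep1 finv fnext :=
  lazymatch type of fnext with next_cell _ ?i _ _ =>
    solve [cell finv i i; try contra finv fnext; cell finv i.+1 i.+1;
      contra finv fnext]
  end.

(** No letter b or b' may arrive just west of a b', hence [fE], the negation of (S5). [nS4] keeps a
    second a-box off the diagonal; a primed mover needs no such hypothesis, as an a-box at (i, i)
    would then be a second a' in its row. *)
Lemma move_south_perforated f i j s e (finv : switching_inv f) (fnext : next_cell f i j s)
  (fS : f i.+1 j = Bcell e)
  (fE : forall x y t, f x y = Bcell t -> x = i /\ y = j.+1 /\ t = true -> False)
  (nS4 : s = false -> forall x y t, f x y = Acell t ->
     i.+1 = j /\ x = i /\ y = i -> False) :
  perforated (move_south f i j s e).
Proof.
have fc := mover_cell fnext.
have dom u v : isSome (move_south f i j s e u v) = isSome (f u v).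
  rewrite /move_south /upd; case: andP => [[/eqP -> /eqP ->]|_]; first by rewrite fS.
  by case: andP => [[/eqP -> /eqP ->]|_] //; rewrite fc.
split.
- exact: plane_eqdom (inv_perforated finv) dom.
- exact: convex_eqdom (inv_perforated finv) dom.
{ move=> l0 i0 j0 k l ? ? ? ?; (have [?|?] : i < i0 \/ i0 <= i by lia);
  (have [?|?] : i < k \/ k <= i by lia).
  all: start finv split_south; finish finv fnext. }
{ start finv split_south; finish finv fnext. }
{ move=> l0 i0 j0 k h1 h2 lt; have i0i : i0 = i \/ i0 <> i by lia.
  have hj : i0 = j0 \/ i0 < j0 by have := plane_eqdom (inv_perforated finv) dom h1; lia.
  case: hj => hj; case: i0i => i0i.
  all: start finv split_south; finish finv fnext. }
{ start finv split_south; first [light_lia | contra finv fnext | bools];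
    first [contra finv fnext | deep finv fnext | close finv fnext]. }
{ move=> i0 j0 k l r h1 h2 h3 *.
  (have [?|?] : i.+1 <= j0 \/ j0 <= i by lia); (have [?|?] : i.+1 = j \/ i.+1 <> j by lia).
  all: start finv split_south; first [light_lia | contra finv fnext | bools];
    first [contra finv fnext | deep1 finv fnext | close finv fnext]. }
{ start finv split_south; finish finv fnext. }
Qed.

Lemma move_south_straddled f i j s e (finv : switching_inv f) (fnext : next_cell f i j s)
  (fS : f i.+1 j = Bcell e) x y r :
  move_south f i j s e x y = Acell r -> straddled (move_south f i j s e) x y ->
  next_cell (move_south f i j s e) x y r.
Proof.
have fc := mover_cell fnext => fx [u [v [u' [v' [t [t' [fu fu' [h1 h1'] [h2 h2']]]]]]]].
have [ex ey] : x = i.+1 /\ y = j.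
  have [?|?] : i < x \/ x <= i by lia.
    by start finv split_south; finish finv fnext.
  by start finv split_south; finish finv fnext.
subst x y; have {fx} er : r = s by start finv split_south; lia.
subst r; apply: next_cellI.
  split; first by rewrite /move_south upd_eq.
  have [lt_v|le_v] : j < v' \/ v' <= j by lia.
    have [t0 ft0] : exists t0, f i.+1 j.+1 = Bcell t0.
      start finv split_south; try light_lia; cell finv i.+1 j.+1;
        try contra finv fnext; try (by eexists; eassumption).
    by exists t0; left; rewrite /move_south !upd_neq //; right; lia.
  have [t0 ft0] : exists t0, f i.+2 j = Bcell t0.
    start finv split_south; try light_lia; cell finv i.+2 j;
        try contra finv fnext; try (by eexists; eassumption).
  by exists t0; right; rewrite /move_south !upd_neq //; left; lia.
all: clear fu fu' h1 h2 h1' h2'; start finv split_south; finish finv fnext.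
Qed.

(** The middle box loses its prime because the b-letter [e] arrives just west of it: b' after b
    breaks the order, b' after b' the row condition. *)
Definition move_S3 (f : cells) i s e :=
  upd (upd (upd f i i (Bcell e)) i i.+1 (Bcell false)) i.+1 i.+1 (Acell s).

Lemma move_S3P f i s e u v y : move_S3 f i s e u v = y ->
  [\/ [/\ u = i, v = i & y = Bcell e], [/\ u = i, v = i.+1 & y = Bcell false],
      [/\ u = i.+1, v = i.+1 & y = Acell s] |
      [/\ u <> i \/ v <> i, u <> i \/ v <> i.+1, u <> i.+1 \/ v <> i.+1 & f u v = y]].
Proof.
case/updP => [[? [? ?]]|[h /updP]]; first by constructor 3.
case=> [[? [? ?]]|[h' /updP]]; first by constructor 2.
by case=> [[? [? ?]]|[h'' ?]]; [constructor 1 | constructor 4].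
Qed.

Ltac split_S3 :=
  repeat match goal with
  | H : move_S3 _ _ _ _ _ _ = _ |- _ =>
      case/move_S3P: H => [[? ? ?]|[? ? ?]|[? ? ?]|[? ? ? H]]
  end.

Lemma move_S3_perforated f i s e (finv : switching_inv f) (fnext : next_cell f i i s)
  (fE : f i i.+1 = Bcell true) (fF : f i.+1 i.+1 = Bcell e) :
  perforated (move_S3 f i s e).
Proof.
have fc := mover_cell fnext.
have dom u v : isSome (move_S3 f i s e u v) = isSome (f u v).
  rewrite /move_S3 /upd; case: andP => [[/eqP -> /eqP ->]|_]; first by rewrite fF.
  case: andP => [[/eqP -> /eqP ->]|_]; first by rewrite fE.
  by case: andP => [[/eqP -> /eqP ->]|_] //; rewrite fc.
split.
- exact: plane_eqdom (inv_perforated finv) dom.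
- exact: convex_eqdom (inv_perforated finv) dom.
{ move=> l0 i0 j0 k l ? ? ? ?; (have [?|?] : i < i0 \/ i0 <= i by lia);
  (have [?|?] : i < k \/ k <= i by lia).
  all: (have [?|?] : i < j0 \/ j0 <= i by lia); (have [?|?] : i < l \/ l <= i by lia).
  all: start finv split_S3; try contra finv fnext; finish finv fnext. }
{ start finv split_S3; finish finv fnext. }
{ start finv split_S3; finish finv fnext. }
{ start finv split_S3; finish finv fnext. }
{ start finv split_S3; finish finv fnext. }
{ start finv split_S3; finish finv fnext. }
Qed.

Lemma move_S3_straddled f i s e (finv : switching_inv f) (fnext : next_cell f i i s)
  (fE : f i i.+1 = Bcell true) (fF : f i.+1 i.+1 = Bcell e) x y r :
  move_S3 f i s e x y = Acell r -> straddled (move_S3 f i s e) x y ->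
  next_cell (move_S3 f i s e) x y r.
Proof.
have fc := mover_cell fnext => fx [u [v [u' [v' [t [t' [fu fu' [h1 h1'] [h2 h2']]]]]]]].
have [ex ey] : x = i.+1 /\ y = i.+1.
  have [?|?] : i < y \/ y <= i by lia.
    by start finv split_S3; finish finv fnext.
  by start finv split_S3; finish finv fnext.
subst x y; have {fx} er : r = s by start finv split_S3; lia.
subst r; apply: next_cellI.
  split; first by rewrite /move_S3 upd_eq.
  have [t0 ft0] : exists t0, f i.+1 i.+2 = Bcell t0.
    start finv split_S3; try light_lia; cell finv i.+1 i.+2;
        try contra finv fnext; try (by eexists; eassumption).
  by exists t0; left; rewrite /move_S3 !upd_neq //; lia.
all: clear fu fu' h1 h2 h1' h2'; start finv split_S3; finish finv fnext.
Qed.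

(** The middle box gets a prime because an a-box arrives just below it: an unprimed a there would
    break the order or the column condition. (S4) and (S7) differ only in the east neighbor, which
    neither changes. *)
Definition move_S47 (f : cells) i s e :=
  upd (upd (upd f i i (Bcell e)) i i.+1 (Acell true)) i.+1 i.+1 (Acell s).

Lemma move_S47P f i s e u v y : move_S47 f i s e u v = y ->
  [\/ [/\ u = i, v = i & y = Bcell e], [/\ u = i, v = i.+1 & y = Acell true],
      [/\ u = i.+1, v = i.+1 & y = Acell s] |
      [/\ u <> i \/ v <> i, u <> i \/ v <> i.+1, u <> i.+1 \/ v <> i.+1 & f u v = y]].
Proof.
case/updP => [[? [? ?]]|[h /updP]]; first by constructor 3.
case=> [[? [? ?]]|[h' /updP]]; first by constructor 2.
by case=> [[? [? ?]]|[h'' ?]]; [constructor 1 | constructor 4].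
Qed.

Ltac split_S47 :=
  repeat match goal with
  | H : move_S47 _ _ _ _ _ _ = _ |- _ =>
      case/move_S47P: H => [[? ? ?]|[? ? ?]|[? ? ?]|[? ? ? H]]
  end.

(** Needed because the new a' at (i, i.+1) must have no unprimed a north-west of it. *)
Lemma corner_unprimed f i s e (finv : switching_inv f) (fnext : next_cell f i i.+1 false)
  (fW : f i i = Acell s) (fF : f i.+1 i.+1 = Bcell e) :
  forall x y t, f x y = Acell t -> t = false /\ x < i /\ y <= i.+1 -> False.
Proof.
move=> x y t fx [tF [hx hy]]; subst t; have fc := mover_cell fnext.
have le_xy := perf_plane (inv_perforated finv) fx.
have [?|[?|?]] : y = i.+1 \/ y = i \/ y < i by lia.
- by contra finv fnext.
- by bools; contra finv fnext.
(* The box (y, y) lies between (x, y) and (i, i), and would join (i, i) as a second a-box, or (i.+1,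
   i.+1) as a second b-box, on the diagonal. *)
- by cell finv y y; contra finv fnext.
Qed.

Lemma move_S47_perforated f i s e (finv : switching_inv f) (fnext : next_cell f i i.+1 false)
  (fW : f i i = Acell s) (fF : f i.+1 i.+1 = Bcell e)
  (fE : forall x y t, f x y = Bcell t -> x = i /\ y = i.+2 /\ t = true -> False) :
  perforated (move_S47 f i s e).
Proof.
have fc := mover_cell fnext.
have dom u v : isSome (move_S47 f i s e u v) = isSome (f u v).
  rewrite /move_S47 /upd; case: andP => [[/eqP -> /eqP ->]|_]; first by rewrite fF.
  case: andP => [[/eqP -> /eqP ->]|_]; first by rewrite fc.
  by case: andP => [[/eqP -> /eqP ->]|_] //; rewrite fW.
have noA := corner_unprimed finv fnext fW fF.
split.
- exact: plane_eqdom (inv_perforated finv) dom.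
- exact: convex_eqdom (inv_perforated finv) dom.
{ move=> l0 i0 j0 k l ? ? ? ?.
  (have [?|?] : i < i0 \/ i0 <= i by lia);
  (have [?|?] : i < k \/ k <= i by lia).
  all: start finv split_S47; finish finv fnext. }
{ start finv split_S47; finish finv fnext. }
{ start finv split_S47; finish finv fnext. }
{ start finv split_S47; finish finv fnext. }
{ start finv split_S47; finish finv fnext. }
{ start finv split_S47; finish finv fnext. }
Qed.

(** The box at (i, i.+1) is now primed, so it is next only if no unprimed a-box is switchable any
    more. *)
Lemma move_S47_straddled f i s e (finv : switching_inv f) (fnext : next_cell f i i.+1 false)
  (fW : f i i = Acell s) (fF : f i.+1 i.+1 = Bcell e)
  (fE : forall x y t, f x y = Bcell t -> x = i /\ y = i.+2 /\ t = true -> False) x y r :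
  move_S47 f i s e x y = Acell r -> straddled (move_S47 f i s e) x y ->
  next_cell (move_S47 f i s e) x y r.
Proof.
have noA := corner_unprimed finv fnext fW fF.
have fc := mover_cell fnext => fx [u [v [u' [v' [t [t' [fu fu' [h1 h1'] [h2 h2']]]]]]]].
(* The a-box sent to (i.+1, i.+1) has the b-box (i, i) north-west of it, so it must have no b-box
   south-east of it; the contents of (i.+1, i.+2) and (i, i.+2) show this. *)
have noF : ~ (x = i.+1 /\ y = i.+1).
  move=> [? ?]; clear fu fx; start finv split_S47; try light_lia; bools;
  cell finv i.+1 i.+2; try contra finv fnext; cell finv i i.+2; contra finv fnext.
have [ex ey] : x = i /\ y = i.+1.
  have [//|neq] : (x = i /\ y = i.+1) \/ (x <> i \/ y <> i.+1) by lia.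
  exfalso; (have [?|?] : i < y \/ y <= i by lia); (have [?|?] : i < x \/ x <= i by lia);
  start finv split_S47; finish finv fnext.
subst x y; have {fx} er : r = true by start finv split_S47; lia.
have [t0 ft0] : exists t0, f i i.+2 = Bcell t0.
  by start finv split_S47; try light_lia; cell finv i i.+2; try contra finv fnext; eexists; eassumption.
subst r; apply: next_cellI.
  split; first by rewrite /move_S47 upd_neq ?upd_eq //; lia.
  by exists t0; left; rewrite /move_S47 !upd_neq //; lia.
all: clear fu fu' h1 h2 h1' h2'.
- by [].
- move=> u0 v0 u1 v1 t1 _ h1 h2 *.
  have [?|[?|[?|[?|?]]]] : i.+1 < v0 \/ (v0 <= i.+1 /\ u0 < i) \/ (v0 <= i.+1 /\ i < u0) \/
    (u0 = i /\ v0 <= i) \/ (u0 = i /\ v0 = i.+1) by lia.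
  5: by start finv split_S47; lia.
  4: by start finv split_S47; try contra finv fnext; lia.
  all: start finv split_S47; finish finv fnext.
Qed.

Close Scope coq_nat_scope.

(** * From labelled fillings to perforated fillings *)

From mathcomp Require Import zify.
Local Open Scope nat_scope.

Definition cell_of a b (x : label * letter) : option (label * bool) :=
  match x with
  | (LabS, y) => if y.1 == a then Acell y.2 else None
  | (LabT, y) => if y.1 == b then Bcell y.2 else None
  end.

Definition view a b (U : labelled) : cells := fun i j => obind (cell_of a b) U.[? (i, j)].

Lemma view_A a b (U : labelled) i j s :
  view a b U i j = Acell s <-> U.[? (i, j)] = Some (LabS, (a, s)).
Proof.
rewrite /view; split=> [|->]; last by rewrite /= eqxx.
by case: (U.[? _]) => //= -[[] [k p]] /=; case: eqP => // -> [->].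
Qed.

Lemma view_B a b (U : labelled) i j s :
  view a b U i j = Bcell s <-> U.[? (i, j)] = Some (LabT, (b, s)).
Proof.
rewrite /view; split=> [|->]; last by rewrite /= eqxx.
by case: (U.[? _]) => //= -[[] [k p]] /=; case: eqP => // -> [->].
Qed.

Lemma aboxP a b U i j :
  reflect (exists s, view a b U i j = Acell s) (abox a U (i, j)).
Proof.
rewrite /abox /view; case: (U.[? _]) => [[[] [k p]]|] /=.
- by case: eqP => e; constructor; [exists p | case].
- by constructor=> -[s]; case: eqP.
- by constructor=> -[].
Qed.

Lemma bboxP a b U i j :
  reflect (exists s, view a b U i j = Bcell s) (bbox b U (i, j)).
Proof.
rewrite /bbox /view; case: (U.[? _]) => [[[] [k p]]|] /=.
- by constructor=> -[s]; case: eqP.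
- by case: eqP => e; constructor; [exists p | case].
- by constructor=> -[].
Qed.

Lemma primed_view a b U i j l s : view a b U i j = Some (l, s) -> primed U (i, j) = s.
Proof.
by case: l => [/view_A|/view_B]; rewrite /primed => ->.
Qed.

Lemma view_set a b (U : labelled) i j x :
  view a b U.[(i, j) <- x] = upd (view a b U) i j (cell_of a b x).
Proof.
apply: functional_extensionality => u; apply: functional_extensionality => v.
by rewrite /view /upd fnd_set xpair_eqE; case: andP.
Qed.

Lemma switchableP a b U i j :
  switchable a b U (i, j) <-> exists s, switchable_cell (view a b U) i j s.
Proof.
rewrite /switchable /east /south /=; split.
  case/andP=> /(aboxP a b) [s Us] /orP[] /(bboxP a b) [t Ut]; exists s; split=> //; exists t; auto.
case=> s [Us [t Ut]]; apply/andP; split; first by apply/(aboxP a b); exists s.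
by apply/orP; case: Ut => Ut; [left | right]; apply/(bboxP a b); exists t.
Qed.

Lemma next_boxP a b U i j :
  is_next_box a b U (i, j) <-> exists s, next_cell (view a b U) i j s.
Proof.
rewrite /is_next_box; split.
  case=> /switchableP [s sU] nU; exists s; split=> // u v r sr.
  have [Us _] := sU; have [Ur _] := sr.
  have := nU (u, v); rewrite (primed_view Us) (primed_view Ur) /= => /(_ _)/wrap[].
    by apply/switchableP; exists r.
  by case: (s) => [[? /leP ?] //|H rF]; apply/leP/H; rewrite rF.
case=> s [sU nU]; split; first by apply/switchableP; exists s.
case=> u v /switchableP [r sr]; have := nU _ _ _ sr.
have [Us _] := sU; have [Ur _] := sr.
rewrite (primed_view Us) (primed_view Ur) /=; case: (s) => [[-> /leP] //|H].
by move=> rF; apply/leP/H; apply: negbTE.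
Qed.

(* Labels become booleans because [label] carries no eqType structure. *)
Definition key_of (x : label * letter) : bool * nat :=
  (if x.1 is LabS then true else false, x.2.1).

Definition keyat (U : labelled) c := omap key_of U.[? c].

Definition outside a b (U : labelled) c :=
  (keyat U c != Some (true, a)) && (keyat U c != Some (false, b)).

(* Up to primes, every switch exchanges two boxes. *)
Definition key_swap a b (U V : labelled) (d e : box) :=
  [/\ keyat U d = Some (true, a), keyat U e = Some (false, b),
      d.1 + d.2 < e.1 + e.2,
      forall c, keyat V c = if c == d then keyat U e else
                            if c == e then keyat U d else keyat U c
    & forall c, outside a b U c -> V.[? c] = U.[? c]].

Section Step.

Variables (a b : nat) (U : labelled) (i j : nat) (s : bool).
Let f := view a b U.
Hypothesis finv : switching_inv f.
Hypothesis fnext : next_cell f i j s.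

Lemma outside_set c x (V : labelled) : keyat U c = Some (true, a) \/ keyat U c = Some (false, b) ->
  (forall d, outside a b U d -> V.[? d] = U.[? d]) ->
  forall d, outside a b U d -> V.[c <- x].[? d] = U.[? d].
Proof.
move=> kc H d od; rewrite fnd_set; case: eqP => [e|_]; last exact: H.
by move: od; rewrite e /outside; case: kc => ->; rewrite eqxx ?andbF.
Qed.

Lemma keyat_view_A u v r : f u v = Acell r -> keyat U (u, v) = Some (true, a).
Proof. by move/view_A; rewrite /keyat => ->. Qed.

Lemma keyat_view_B u v r : f u v = Bcell r -> keyat U (u, v) = Some (false, b).
Proof. by move/view_B; rewrite /keyat => ->. Qed.

Lemma step_exchange u v e : f u v = Bcell e -> i + j < u + v ->
  view a b (exchange U (i, j) (u, v)) = upd (upd f i j (Bcell e)) u v (Acell s) /\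
  key_swap a b U (exchange U (i, j) (u, v)) (i, j) (u, v).
Proof.
move=> fu lt; have fc := mover_cell fnext.
have kA := keyat_view_A fc; have kB := keyat_view_B fu.
have /view_A Uc := fc; have /view_B Uu := fu.
rewrite /exchange Uc Uu; split; first by rewrite !view_set /= !eqxx.
split=> // [c|c].
  rewrite /keyat !fnd_set Uc Uu; case: eqP => [->|] //.
    by case: eqP => [[e1 e2]|//]; move: lt; rewrite e1 e2 ltnn.
  by case: eqP => [->|].
move: c; apply: outside_set; first by right.
by apply: outside_set; first by left.
Qed.

Lemma step_S3 e : i = j -> f i i.+1 = Bcell true -> f i.+1 i.+1 = Bcell e ->
  view a b (apply_S3 b U (i, j)) = move_S3 f i s e /\
  key_swap a b U (apply_S3 b U (i, j)) (i, j) (i.+1, i.+1).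
Proof.
move=> ij fE fF; have fc := mover_cell fnext; rewrite -ij in fc *.
have kA := keyat_view_A fc; have kB := keyat_view_B fF; have kE := keyat_view_B fE.
have /view_A Uc := fc; have /view_B Uu := fF; have /view_B UE := fE.
rewrite /apply_S3 Uc Uu; split; first by rewrite !view_set /= !eqxx.
split=> // [|c|].
- by rewrite /=; lia.
- case: c => u v; rewrite /keyat /east !fnd_set !xpair_eqE Uc Uu /=.
  case: (u =P i.+1) => eu; case: (u =P i) => eu'; case: (v =P i.+1) => ev;
    case: (v =P i) => ev' //=; try lia.
  by rewrite eu' ev UE.
apply: outside_set; first by right.
apply: outside_set; first by right; exact: kE.
by apply: outside_set; first by left.
Qed.

(** In terms of keys the two diagonal boxes are exchanged, although the switch is applied at (i,
    i.+1). *)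
Lemma step_S47 r e : j = i.+1 -> s = false -> f i i = Acell r -> f i.+1 i.+1 = Bcell e ->
  view a b (apply_S4_S7 a U (i, j)) = move_S47 f i r e /\
  key_swap a b U (apply_S4_S7 a U (i, j)) (i, i) (i.+1, i.+1).
Proof.
move=> ij sF fW fF; have fc := mover_cell fnext; rewrite ij sF in fc *.
have kA := keyat_view_A fW; have kB := keyat_view_B fF; have kc := keyat_view_A fc.
have /view_A UW := fW; have /view_B Uu := fF; have /view_A Uc := fc.
rewrite /apply_S4_S7 /south /= UW Uu; split; first by rewrite !view_set /= !eqxx.
split=> // [|c|].
- by rewrite /=; lia.
- case: c => u v; rewrite /keyat !fnd_set !xpair_eqE UW Uu /=.
  case: (u =P i.+1) => eu; case: (u =P i) => eu'; case: (v =P i.+1) => ev;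
    case: (v =P i) => ev' //=; try lia.
  by rewrite eu' ev Uc.
apply: outside_set; first by right.
apply: outside_set; first by left; exact: kc.
by apply: outside_set; first by left.
Qed.

Lemma bboxF u v : bbox b U (u, v) = false -> forall t, f u v <> Bcell t.
Proof. by move/(bboxP a b) => H t ft; apply: H; exists t. Qed.

(** The failed tests of [switch] supply the exclusions required by the move lemmas. [eastP] serves
    (S1) and (S5), [southP] serves (S2) and (S6). *)
Theorem switch_step :
  switching_inv (view a b (switch a b U (i, j))) /\
  exists d e, key_swap a b U (switch a b U (i, j)) d e.
Proof.
have fc := mover_cell fnext; have pc := primed_view fc.
have bf := inv_perforated finv.
rewrite /switch /east /south /=.
case: ifP => [/and4P[/eqP ji /(bboxP a b)[t fE] pE /(bboxP a b)[e fF]]|nS3].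
  rewrite (primed_view fE) in pE; rewrite /= pE ji in fE.
  have fn : next_cell f i i s by rewrite -{2}ji.
  have [-> ks] := step_S3 (esym ji) fE fF; split; last by exists (i, j), (i.+1, i.+1).
  by split; [exact: move_S3_perforated | move=> *; apply: (move_S3_straddled finv fn fE fF)].
case: ifP => [S47|nS47].
  have [cor nE] : corner_S4_S7 a b U (i, j) /\ forall t, f i j.+1 = Bcell t -> t = false.
    case/orP: S47 => [/andP[c nb]|/and3P[c _ np]]; split=> // t ft.
      by case: (@bboxF i j.+1 _ t ft); apply: negbTE.
    by apply: negbTE; rewrite -(primed_view ft).
  move: cor; rewrite /corner_S4_S7 pc => /and4P[/eqP ji sF /(aboxP a b)[r fW] /(bboxP a b)[e fF]].
  move/negbTE in sF; rewrite /south /= ji -/f in fF.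
  have [-> ks] := step_S47 ji sF fW fF; split; last by exists (i, i), (i.+1, i.+1).
  have fn : next_cell f i i.+1 false by rewrite -sF -ji.
  have fE x y t : f x y = Bcell t -> x = i /\ y = i.+2 /\ t = true -> False.
    by move=> ft [e1 [e2 e3]]; subst; have := nE _ ft.
  by split; [exact: move_S47_perforated | move=> *; apply: (move_S47_straddled finv fn fW fF fE)].
have nS4 : (bbox b U (i, j.+1) -> primed U (i, j.+1) = false) ->
    s = false -> forall x y t, f x y = Acell t -> i.+1 = j /\ x = i /\ y = i ->
    bbox b U (i.+1, j) -> False.
  move=> nE sF x y t ft [e1 [e2 e3]] bS; move: nS47; rewrite /is_S4 /is_S7 /corner_S4_S7 pc sF.
  have -> : abox a U (i, i) by apply/(aboxP a b); exists t; rewrite -{1}e2 -e3.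
  rewrite /south /east /= bS (introT eqP (esym e1)) /=.
  by case bE: (bbox b U (i, j.+1)) => /=; rewrite ?nE.
have eastP e : f i j.+1 = Bcell e -> (e = true \/ bbox b U (i.+1, j) = false) ->
   switching_inv (view a b (exchange U (i, j) (i, j.+1))) /\
   exists d e, key_swap a b U (exchange U (i, j) (i, j.+1)) d e.
  move=> fE eS; have [|-> ks] := step_exchange fE; first by lia.
  split; last by exists (i, j), (i, j.+1).
  split; last by move=> *; apply: (move_east_straddled finv fnext fE).
  apply: move_east_perforated => //.
    move=> eF x y t ft [e1 e2]; case: eS; first by rewrite eF.
    by move/bboxF => /(_ t); rewrite -e1 -e2.
  move=> eT x y t ft [e1 [e2 e3]]; move: nS3; rewrite /is_S3 /east /= -e1 eqxx /=.
  have -> : bbox b U (i, i.+1) by apply/(bboxP a b); exists e; rewrite {2}e1.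
  have -> : bbox b U (i.+1, i.+1) by apply/(bboxP a b); exists t; rewrite -{1}e2 -e3.
  by rewrite {2}e1 (primed_view fE) eT.
have southP e : f i.+1 j = Bcell e -> (bbox b U (i, j.+1) -> primed U (i, j.+1) = false) ->
   switching_inv (view a b (exchange U (i, j) (i.+1, j))) /\
   exists d e, key_swap a b U (exchange U (i, j) (i.+1, j)) d e.
  move=> fS eE; have [|-> ks] := step_exchange fS; first by lia.
  split; last by exists (i, j), (i.+1, j).
  split; last by move=> *; apply: (move_south_straddled finv fnext fS).
  apply: move_south_perforated => //.
    move=> x y t ft [e1 [e2 e3]]; subst x y t; have := primed_view ft.
    by rewrite eE //; apply/(bboxP a b); exists true.
  by move=> sF x y t ft h; apply: (nS4 eE sF x y t ft h); apply/(bboxP a b); exists e.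
case bE: (bbox b U (i, j.+1)); case bS: (bbox b U (i.+1, j)) => /=.
- have /(bboxP a b) [t fE] := bE; have /(bboxP a b) [t' fS] := bS.
  case: ifP => pE; first by apply: (eastP t) => //; left; rewrite -(primed_view fE).
  by apply: (southP t').
- by have /(bboxP a b) [t fE] := bE; apply: (eastP t) => //; right.
- by have /(bboxP a b) [t' fS] := bS; apply: (southP t') => //; rewrite bE.
- have [[_ [t ft]] _] := fnext; case: ft => ft.
    by case: (bboxF bE ft).
  by case: (bboxF bS ft).
Qed.

End Step.

(** * Conserved quantities and termination of a process *)

Lemma keyat_dom (U : labelled) c : (keyat U c : bool) = (c \in domf U).
Proof. by rewrite /keyat -fndSome; case: (U.[? c]). Qed.

Lemma keyat_eq_domf (U V : labelled) :
  (forall c, (keyat U c : bool) = keyat V c) -> domf U = domf V.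
Proof. by move=> H; apply/fsetP => c; rewrite -!keyat_dom H. Qed.

Lemma key_swap_neq a b U V d e : key_swap a b U V d e -> d != e.
Proof. by case=> _ _ lt _ _; apply/eqP => de; rewrite de ltnn in lt. Qed.

Lemma key_swap_domf a b U V d e : key_swap a b U V d e -> domf V = domf U.
Proof.
case=> kd ke _ H _; apply: keyat_eq_domf => c; rewrite H.
by case: eqP => [->|_]; rewrite ?kd ?ke //; case: eqP => [->|]; rewrite ?kd ?ke.
Qed.

Lemma key_swap_outside a b U V d e : key_swap a b U V d e ->
  forall c, outside a b V c = outside a b U c.
Proof.
case=> kd ke _ H _ c; rewrite /outside H.
case: (c =P d) => [->|_]; rewrite ?kd ?ke ?eqxx ?andbF //.
by case: (c =P e) => [->|_]; rewrite ?kd ?ke ?eqxx ?andbF.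
Qed.

(** Only the terms at d and e change. With the indicator of a key this gives the weights, with
    coordinate sums it gives termination. *)
Lemma key_swap_sum a b U V d e (F : box -> option (bool * nat) -> nat) :
  key_swap a b U V d e -> exists R,
    \sum_(c <- domf U) F c (keyat V c) = F d (keyat U e) + (F e (keyat U d) + R) /\
    \sum_(c <- domf U) F c (keyat U c) = F d (keyat U d) + (F e (keyat U e) + R).
Proof.
move=> ks; have ne := key_swap_neq ks; case: ks => kd ke _ H _.
have dU : d \in domf U by rewrite -keyat_dom kd.
have eU : e \in domf U by rewrite -keyat_dom ke.
have split2 G : \sum_(c <- domf U) G c =
    G d + (G e + \sum_(c <- domf U | (c != d) && (c != e)) G c).
  rewrite (bigD1_seq d) ?fset_uniq //= -big_filter (bigD1_seq e) ?filter_uniq ?fset_uniq //=; last first.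
    by rewrite mem_filter eU eq_sym ne.
  by rewrite big_filter_cond.
exists (\sum_(c <- domf U | (c != d) && (c != e)) F c (keyat U c)).
rewrite !split2 !H !eqxx [e == d]eq_sym (negbTE ne); split=> //; congr (_ + (_ + _)).
by apply: eq_bigr => c /andP[/negbTE nd /negbTE ne']; rewrite H nd ne'.
Qed.

Definition count_key (U : labelled) (k : bool * nat) :=
  \sum_(c <- domf U) (keyat U c == Some k).

Lemma key_swap_count a b U V d e k : key_swap a b U V d e ->
  count_key V k = count_key U k.
Proof.
move=> ks; rewrite /count_key (key_swap_domf ks).
have [R [-> ->]] := key_swap_sum (fun _ x => x == Some k) ks.
by rewrite addnCA.
Qed.

(** Grows at every switch, and is bounded by the coordinate sum of the whole shape, which switches
    leave unchanged. *)
Definition potential a (U : labelled) :=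
  \sum_(c <- domf U) (keyat U c == Some (true, a)) * (c.1 + c.2).

Lemma key_swap_potential a b U V d e : key_swap a b U V d e ->
  potential a U < potential a V.
Proof.
move=> ks; rewrite /potential (key_swap_domf ks).
have [R [-> ->]] := key_swap_sum (fun c x => (x == Some (true, a)) * (c.1 + c.2)) ks.
by case: ks => -> -> lt _ _; rewrite eqxx /=; lia.
Qed.

Lemma potential_le a U : potential a U <= \sum_(c <- domf U) (c.1 + c.2).
Proof. by apply: leq_sum => c _; case: eqP => _; rewrite ?mul1n. Qed.

Section NextBox.

Variables (a b : nat) (U : labelled).

Lemma switchable_domf c : switchable a b U c -> c \in domf U.
Proof.
by case/andP; rewrite /abox -fndSome; case: (U.[? c]).
Qed.

Lemma max_switchable (P : pred box) (m : box -> nat) :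
  (exists2 c, switchable a b U c & P c) ->
  exists2 c, switchable a b U c /\ P c &
    forall d, switchable a b U d -> P d -> m d <= m c.
Proof.
case=> c sc Pc; pose Q (x : domf U) := switchable a b U (val x) && P (val x).
have Qc : Q [` switchable_domf sc] by rewrite /Q /= sc.
have [x /andP[sx Px] xmax] := @arg_maxnP _ [` switchable_domf sc] Q (fun x => m (val x)) Qc.
exists (val x) => // d sd Pd.
by have /= := xmax [` switchable_domf sd]; apply; rewrite /Q /= sd.
Qed.

Lemma next_box_exists c : switchable a b U c -> exists d, is_next_box a b U d.
Proof.
move=> sc.
have [/existsP[/= x /andP[sx px]]|nP] :=
    boolP [exists x : domf U, switchable a b U (val x) && ~~ primed U (val x)].
  have [|d [sd pd] dmax] := @max_switchable (fun c => ~~ primed U c) snd; first by exists (val x).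
  by exists d; split=> // e se; rewrite (negbTE pd) => pe; apply: dmax.
have Pall d : switchable a b U d -> primed U d.
  move=> sd; apply: contraNT nP => pd; apply/existsP.
  by exists [` switchable_domf sd]; rewrite /= sd pd.
have [|d [sd _] dmax] := @max_switchable predT fst; first by exists c.
by exists d; split=> // e se; rewrite (Pall _ sd); split; [exact: Pall | exact: dmax].
Qed.

Lemma fully_switched_or : fully_switched a b U \/ exists c, switchable a b U c.
Proof.
have [/existsP[x sx]|nP] := boolP [exists x : domf U, switchable a b U (val x)].
  by right; exists (val x).
left=> c; apply: contra nP => sc; apply/existsP.
by exists [` switchable_domf sc].
Qed.

End NextBox.

Definition same_class a b (U V : labelled) :=
  [/\ domf V = domf U, forall c, outside a b V c = outside a b U c,
      forall c, outside a b U c -> V.[? c] = U.[? c]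
    & count_key V =1 count_key U].

Lemma same_class_trans a b U V W :
  same_class a b U V -> same_class a b V W -> same_class a b U W.
Proof.
case=> [h1 h2 h3 h4] [k1 k2 k3 k4]; split=> [|c|c oc|k].
- by rewrite k1.
- by rewrite k2.
- by rewrite k3 ?h2 // h3.
- by rewrite k4.
Qed.

Lemma switch_next a b U c : switching_inv (view a b U) -> is_next_box a b U c ->
  switching_inv (view a b (switch a b U c)) /\
  exists d e, key_swap a b U (switch a b U c) d e.
Proof. by case: c => i j Uinv /next_boxP [s sn]; apply: switch_step sn. Qed.

Theorem switching_process_spec a b U V : switching_inv (view a b U) ->
  switching_process a b U V ->
  [/\ switching_inv (view a b V), fully_switched a b V & same_class a b U V].
Proof.
move=> Uinv p; elim: p Uinv => {U V} [U fU|U c V nc _ IH] Uinv; first by split.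
have [Winv [d [e ks]]] := switch_next Uinv nc.
have [Vinv fV WV] := IH Winv; split=> //; apply: same_class_trans WV.
split; first exact: key_swap_domf ks.
- exact: key_swap_outside ks.
- by case: ks.
- by move=> k; apply: key_swap_count ks.
Qed.

Theorem switching_process_exists a b U : switching_inv (view a b U) ->
  exists V, switching_process a b U V.
Proof.
have [n] := ubnP ((\sum_(c <- domf U) (c.1 + c.2)) - potential a U).
elim: n U => // n IH U lt_n Uinv.
have [fU|[c /next_box_exists[d nd]]] := fully_switched_or a b U.
  by exists U; constructor.
have [Winv [d' [e ks]]] := switch_next Uinv nd.
have [|V pV] := IH _ _ Winv; last by exists V; apply: process_step pV.
have := key_swap_potential ks; have := potential_le a (switch a b U d).
by rewrite (key_swap_domf ks); move: lt_n; lia.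
Qed.

(** * Convex shapes, and one process among many letters *)

Definition in_plane (c : box) := 1 <= c.1 <= c.2.

Definition le_box (c d : box) := (c.1 <= d.1) && (c.2 <= d.2).

(** The middle box must be in the shifted plane, because the rectangle spanned by two boxes may
    reach below the diagonal. *)
Definition convex (D : {fset box}) :=
  (forall c, c \in D -> in_plane c) /\
  (forall c d e, c \in D -> e \in D -> in_plane d -> le_box c d -> le_box d e -> d \in D).

(* [le] is the order in which the classes of boxes with the same label and
   letter are nested. *)
Record good (le : rel (bool * nat)) (U : labelled) : Prop := Good {
  good_convex : convex (domf U);
  good_le : forall c d x y, U.[? c] = Some x -> U.[? d] = Some y -> le_box c d ->
    le (key_of x) (key_of y);
  good_ord : forall c d x y, U.[? c] = Some x -> U.[? d] = Some y ->
    key_of x = key_of y -> le_box c d -> x.2.2 || ~~ y.2.2;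
  good_col : forall i k j x y, U.[? (i, j)] = Some x -> U.[? (k, j)] = Some y ->
    key_of x = key_of y -> ~~ x.2.2 -> ~~ y.2.2 -> i = k;
  good_row : forall i j k x y, U.[? (i, j)] = Some x -> U.[? (i, k)] = Some y ->
    key_of x = key_of y -> x.2.2 -> y.2.2 -> j = k
}.

Section GoodStep.

Variables (a b : nat) (le le' : rel (bool * nat)).

Definition in_class (k : bool * nat) := (k == (true, a)) || (k == (false, b)).

(** [le] is the order of the classes before the process, [le'] the one after it. By [le_class] the
    two classes are consecutive: any other class compares in the same way with both. [le'_ba] grants
    every relation inside the pair except a before b, the one that the process removes. *)
Hypothesis le_anti : forall k l, le k l -> le l k -> k = l.
Hypothesis le_ab : ~~ le (false, b) (true, a).
Hypothesis le_class : forall k x y, in_class x -> in_class y -> ~~ in_class k ->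
  le k x = le k y /\ le x k = le y k.
Hypothesis le_le' : forall k l, ~~ in_class k || ~~ in_class l -> le k l -> le' k l.
Hypothesis le'_ba : forall k l, in_class k -> in_class l ->
  (k, l) != ((true, a), (false, b)) -> le' k l.

Lemma outsideE (U : labelled) c x : U.[? c] = Some x -> outside a b U c = ~~ in_class (key_of x).
Proof.
move=> Uc; rewrite /outside /keyat Uc /in_class negb_or.
by congr (~~ _ && ~~ _); apply/eqP/eqP => [[->]|->].
Qed.

Lemma viewE (U : labelled) i j l s : view a b U i j = Some (l, s) ->
  exists x, [/\ U.[? (i, j)] = Some x, in_class (key_of x), x.1 = l & x.2.2 = s].
Proof.
case: l => [/view_A|/view_B] ->; [exists (LabS, (a, s)) | exists (LabT, (b, s))].
all: by split=> //; rewrite /in_class eqxx ?orbT.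
Qed.

Lemma view_in_class (U : labelled) i j x : U.[? (i, j)] = Some x -> in_class (key_of x) ->
  view a b U i j = Some (x.1, x.2.2).
Proof.
rewrite /view => -> /=; case: x => -[] [k p] /=; rewrite /in_class !xpair_eqE /=.
  by rewrite orbF => ->.
by move=> ->.
Qed.

Lemma key_of_class x y : in_class (key_of x) -> in_class (key_of y) -> x.1 = y.1 ->
  key_of x = key_of y.
Proof.
case: x => -[] [k p]; case: y => -[] [l q] //=; rewrite /in_class /key_of !xpair_eqE /= ?orbF.
  by move=> /eqP -> /eqP ->.
by move=> /eqP -> /eqP ->.
Qed.

Lemma domf_some (U : labelled) c x : U.[? c] = Some x -> c \in domf U.
Proof. by rewrite -fndSome => ->. Qed.

Lemma some_domf (U : labelled) c : c \in domf U -> exists x, U.[? c] = Some x.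
Proof. by rewrite -fndSome; case: (U.[? c]) => // x; exists x. Qed.

(** A key outside the two classes that lies above [key_of x] also lies above [key_of y], by
    [le_class]; being below it too, it equals it by antisymmetry, a contradiction. *)
Lemma good_between (U : labelled) c d e x y : good le U ->
  U.[? c] = Some x -> U.[? e] = Some y -> in_class (key_of x) -> in_class (key_of y) ->
  in_plane d -> le_box c d -> le_box d e ->
  exists2 z, U.[? d] = Some z & in_class (key_of z).
Proof.
move=> Ug Uc Ue kx ky pd cd de.
have [z Ud] := some_domf ((good_convex Ug).2 _ _ _ (domf_some Uc) (domf_some Ue) pd cd de).
exists z => //; apply/negPn/negP => nz.
have h1 := good_le Ug Uc Ud cd; have h2 := good_le Ug Ud Ue de.
have [_ e1] := le_class kx ky nz; rewrite e1 in h1.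
by move: nz; rewrite (le_anti h2 h1) ky.
Qed.

Lemma good_noBA U u v i j t s : good le U -> view a b U u v = Bcell t ->
  view a b U i j = Acell s -> u <= i -> v <= j -> False.
Proof.
move=> Ug /view_B Uu /view_A Ui h1 h2; have := good_le Ug Uu Ui.
by rewrite /le_box /= h1 h2 => /(_ isT); apply/negP.
Qed.

(** Before the process no b-box is north-west of an a-box. So no a-box is straddled, and the corner
    clauses hold vacuously, since each assumes such a b-box. *)
Lemma good_inv U : good le U -> switching_inv (view a b U).
Proof.
move=> Ug; have cv := good_convex Ug.
have pl i j l s : view a b U i j = Some (l, s) -> 1 <= i <= j.
  by case/viewE => x [/domf_some/(cv.1 _)].
split; last first.
  move=> i j s fi [u [v [u' [v' [t [t' [fu _ [/leP h1 _] [/leP h2 _]]]]]]]].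
  by case: (good_noBA Ug fu fi h1 h2).
split.
- by move=> i j [l s] /pl /andP[_ /leP].
- move=> i j k l u v [l1 s1] [l2 s2] f1 f2 h1 h2 h3 h4 h5.
  have [x [U1 k1 _ _]] := viewE f1; have [y [U2 k2 _ _]] := viewE f2.
  have [|||z U3 k3] := good_between (d := (u, v)) Ug U1 U2 k1 k2.
  + by rewrite /in_plane /=; have := pl _ _ _ _ f1; lia.
  + by rewrite /le_box /=; lia.
  + by rewrite /le_box /=; lia.
  by rewrite (view_in_class U3 k3); eexists; eexists.
- move=> l0 i j k l f1 f2 h1 h2.
  have [x [U1 k1 l1 p1]] := viewE f1; have [y [U2 k2 l2 p2]] := viewE f2.
  have kxy : key_of x = key_of y by apply: key_of_class; rewrite ?l1.
  have le12 : le_box (i, j) (k, l) by rewrite /le_box /=; lia.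
  by have := good_ord Ug U1 U2 kxy le12; rewrite p1 p2.
- move=> l0 i j k f1 f2 lt.
  have [x [U1 k1 l1 p1]] := viewE f1; have [y [U2 k2 l2 p2]] := viewE f2.
  have := good_col Ug U1 U2; rewrite p1 p2 => H.
  by move: lt; rewrite H //; [lia | apply: key_of_class => //; rewrite l1].
- move=> l0 i j k f1 f2 lt.
  have [x [U1 k1 l1 p1]] := viewE f1; have [y [U2 k2 l2 p2]] := viewE f2.
  have := good_row Ug U1 U2; rewrite p1 p2 => H.
  by move: lt; rewrite H //; [lia | apply: key_of_class => //; rewrite l1].
- move=> l0 i j s t f1 f2 lt; have := pl _ _ _ _ f1 => /andP[i1 _].
  have [x [U1 k1 l1 _]] := viewE f1; have [y [U2 k2 l2 _]] := viewE f2.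
  have kxy : key_of x = key_of y by apply: key_of_class; rewrite ?l1.
  (* By convexity (i, i), (i, i.+1) and (i.+1, i.+1) share one key. A primed letter in the middle
     forces two primed ones in row i, an unprimed letter two unprimed ones in column i.+1. *)
  have between d : in_plane d -> le_box (i, i) d -> le_box d (j, j) ->
      exists2 z, U.[? d] = Some z & key_of z = key_of x.
    move=> pd le1 le2; have [z Ud kz] := good_between Ug U1 U2 k1 k2 pd le1 le2.
    exists z => //; apply: le_anti; last exact: (good_le Ug U1 Ud le1).
    by rewrite kxy; apply: (good_le Ug Ud U2 le2).
  have [|||z U3 kz] := between (i, i.+1); rewrite /in_plane /le_box /=; try lia.
  have [|||w U4 kw] := between (i.+1, i.+1); rewrite /in_plane /le_box /=; try lia.
  have b1 : le_box (i, i) (i, i.+1) by rewrite /le_box /=; lia.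
  have b2 : le_box (i, i.+1) (i.+1, i.+1) by rewrite /le_box /=; lia.
  have o1 := good_ord Ug U1 U3 (esym kz) b1.
  have o2 := good_ord Ug U3 U4 (etrans kz (esym kw)) b2.
  case pz: (z.2.2) o1 o2 => o1 o2.
    by rewrite orbF in o1; have := good_row Ug U1 U3 (esym kz) o1 pz; lia.
  by have := good_col Ug U3 U4 (etrans kz (esym kw)) (negbT pz) o2; lia.
- by move=> i j k l r _ f2 f3 _ h1 _; apply: (good_noBA Ug f3 f2); lia.
- by move=> i j k l r _ f2 f3 h1 _ h2; apply: (good_noBA Ug f3 f2); lia.
Qed.

Lemma good_step U V : good le U -> switching_process a b U V ->
  good le' V /\ same_class a b U V.
Proof.
move=> Ug pV; have [Vinv fV sc] := switching_process_spec (good_inv Ug) pV.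
split=> //; case: (sc) => dV oV eV _.
have bf := inv_perforated Vinv.
have out c x : V.[? c] = Some x -> ~~ in_class (key_of x) -> U.[? c] = Some x.
  by move=> Vc nx; rewrite -eV // -oV (outsideE Vc).
have inn c x : V.[? c] = Some x -> in_class (key_of x) ->
    exists2 y, U.[? c] = Some y & in_class (key_of y).
  move=> Vc kx; have [y Uc] : exists y, U.[? c] = Some y.
    by apply: some_domf; rewrite -dV (domf_some Vc).
  by exists y => //; have := oV c; rewrite (outsideE Vc) (outsideE Uc) kx; case: in_class.
split.
- by rewrite dV; apply: good_convex Ug.
- move=> c d x y Vc Vd cd.
  case kx: (in_class (key_of x)); case ky: (in_class (key_of y)).
  + apply: le'_ba => //; apply/eqP => exy.
    have ex : key_of x = (true, a) := congr1 fst exy.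
    have ey : key_of y = (false, b) := congr1 snd exy.
    have eV' : forall z (l : label) k, key_of z = (if l is LabS then true else false, k) -> z.1 = l.
      by case=> -[] ? [] ? //= [].
    move: (Vc) (Vd); case: (c) cd => i j; case: (d) => u v /andP[/= /leP h1 /leP h2] Vc' Vd'.
    have fc := view_in_class Vc' kx; have fd := view_in_class Vd' ky.
    rewrite (eV' _ LabS _ ex) in fc; rewrite (eV' _ LabT _ ey) in fd.
    have [z [w [r [_ _ sw]]]] := exit_cell bf fc fd h1 h2.
    by have := fV (z, w); move/negP; apply; apply/switchableP; exists r.
  (* The box may have passed from one class to the other, a change that [le_class] makes invisible
     to the remaining classes. *)
  + have [z Uc kz] := inn _ _ Vc kx; have Ud := out _ _ Vd (negbT ky).
    apply: le_le'; first by rewrite ky orbT.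
    have [_ ->] := le_class kx kz (negbT ky); exact: (good_le Ug Uc Ud cd).
  + have [z Ud kz] := inn _ _ Vd ky; have Uc := out _ _ Vc (negbT kx).
    apply: le_le'; first by rewrite kx.
    have [-> _] := le_class ky kz (negbT kx); exact: (good_le Ug Uc Ud cd).
  + apply: le_le'; first by rewrite kx.
    exact: (good_le Ug (out _ _ Vc (negbT kx)) (out _ _ Vd (negbT ky)) cd).
- move=> c d x y Vc Vd kxy cd; case kx: (in_class (key_of x)); last first.
    have nx := negbT kx; have ny := nx; rewrite kxy in ny.
    exact: (good_ord Ug (out _ _ Vc nx) (out _ _ Vd ny)).
  have ky := kx; rewrite kxy in ky.
  have lab : x.1 = y.1 by case: (x) (y) kxy => -[] ? [[] ?].
  move: (Vc) (Vd); case: (c) cd => i j; case: (d) => u v /andP[/= /leP h1 /leP h2] Vc' Vd'.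
  have fc := view_in_class Vc' kx; have fd := view_in_class Vd' ky.
  rewrite lab in fc; case px: (x.2.2) fc => //; case py: (y.2.2) fd => // fd fc.
  by case: (perf_ord bf fc fd h1 h2).
- move=> i k j x y Vc Vd kxy px py; case kx: (in_class (key_of x)); last first.
    have nx := negbT kx; have ny := nx; rewrite kxy in ny.
    exact: (good_col Ug (out _ _ Vc nx) (out _ _ Vd ny)).
  have ky := kx; rewrite kxy in ky.
  have lab : x.1 = y.1 by case: (x) (y) kxy => -[] ? [[] ?].
  have fc := view_in_class Vc kx; have fd := view_in_class Vd ky.
  rewrite lab (negbTE px) in fc; rewrite (negbTE py) in fd.
  have [/leP ?|/leP ?|//] := ltngtP i k.
    by case: (perf_col bf fc fd).
  by case: (perf_col bf fd fc).
- move=> i j k x y Vc Vd kxy px py; case kx: (in_class (key_of x)); last first.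
    have nx := negbT kx; have ny := nx; rewrite kxy in ny.
    exact: (good_row Ug (out _ _ Vc nx) (out _ _ Vd ny)).
  have ky := kx; rewrite kxy in ky.
  have lab : x.1 = y.1 by case: (x) (y) kxy => -[] ? [[] ?].
  have fc := view_in_class Vc kx; have fd := view_in_class Vd ky.
  rewrite lab px in fc; rewrite py in fd.
  have [/leP ?|/leP ?|//] := ltngtP j k.
    by case: (perf_row bf fc fd).
  by case: (perf_row bf fd fc).
Qed.

End GoodStep.

(* The order of the classes when the pairs (l, k) with [done l k] have been
   switched: a class of T has moved before the classes of S done with it. *)
Definition key_le (done : nat -> nat -> bool) : rel (bool * nat) := fun x y =>
  match x, y with
  | (true, l), (true, l') => l <= l'
  | (false, k), (false, k') => k <= k'
  | (true, l), (false, k) => ~~ done l k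
  | (false, k), (true, l) => done l k
  end.

(** The state just before the pair (i, j). The chain then reads: S-letters below i, T-letters below
    j, S-letter i, T-letters from j on, S-letters above i; so S-letter i and T-letter j are indeed
    neighbors. *)
Definition done_before i j l k := (i < l) || ((l == i) && (k < j)).

Lemma key_le_anti done x y : key_le done x y -> key_le done y x -> x = y.
Proof.
case: x y => [[] l] [[] k] //= h1 h2; first by congr (_, _); lia.
- by move/negP: h1.
- by move/negP: h2.
- by congr (_, _); lia.
Qed.

Lemma done_before_class i j k x y : in_class i j x -> in_class i j y -> ~~ in_class i j k ->
  key_le (done_before i j) k x = key_le (done_before i j) k y /\
  key_le (done_before i j) x k = key_le (done_before i j) y k.
Proof.
case: k => -[] k /orP[] /eqP -> /orP[] /eqP ->; rewrite /in_class !xpair_eqE /=;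
  rewrite /done_before; split; lia.
Qed.

Lemma good_step_before i j U V : good (key_le (done_before i j)) U ->
  switching_process i j U V ->
  good (key_le (done_before i j.+1)) V /\ same_class i j U V.
Proof.
apply: good_step.
- exact: key_le_anti.
- by rewrite /= /done_before; lia.
- exact: done_before_class.
- move=> [[] k] [[] l]; rewrite /in_class !xpair_eqE /= /done_before; lia.
- by move=> k l /orP[] /eqP -> /orP[] /eqP -> //=; rewrite ?eqxx // /done_before; lia.
Qed.

Lemma good_sub (le le' : rel (bool * nat)) U : good le U ->
  (forall c d x y, U.[? c] = Some x -> U.[? d] = Some y ->
     le (key_of x) (key_of y) -> le' (key_of x) (key_of y)) ->
  good le' U.
Proof.
case=> g1 g2 g3 g4 g5 H; split=> // c d x y Uc Ud cd.
exact: (H _ _ _ _ Uc Ud (g2 _ _ _ _ Uc Ud cd)).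
Qed.

Definition letters_within m n (U : labelled) := forall c x, U.[? c] = Some x ->
  1 <= x.2.1 <= (if x.1 is LabS then m else n).

Definition same_content (U V : labelled) := domf V = domf U /\ count_key V =1 count_key U.

Lemma same_content_trans U V W :
  same_content U V -> same_content V W -> same_content U W.
Proof. by case=> h1 h2 [k1 k2]; split=> [|k]; rewrite ?k1 ?k2. Qed.

Lemma count_key_gt0 (U : labelled) k :
  reflect (exists c x, U.[? c] = Some x /\ key_of x = k) (0 < count_key U k).
Proof.
apply: (iffP idP) => [|[c [x [Uc <-]]]].
  rewrite /count_key lt0n sum_nat_seq_neq0 => /hasP[c _ /=].
  rewrite /keyat; case Uc: (U.[? c]) => [x|] //=; rewrite eqb0 negbK => /eqP[e].
  by exists c, x.
have cU : c \in domf U by rewrite -fndSome Uc.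
by rewrite /count_key (bigD1_seq c) ?fset_uniq //= /keyat Uc eqxx.
Qed.

Lemma same_content_within m n U V : same_content U V ->
  letters_within m n U -> letters_within m n V.
Proof.
case=> _ cUV H c x Vc; have : 0 < count_key V (key_of x) by apply/count_key_gt0; exists c, x.
rewrite cUV => /count_key_gt0[d [y [/H]]].
by case: x {Vc} y => [[] [k p]] [[] [l q]] //= H' [e]; rewrite -e.
Qed.

Lemma switching_sequence_cat ps qs U W :
  switching_sequence (ps ++ qs) U W <->
  exists2 V, switching_sequence ps U V & switching_sequence qs V W.
Proof.
elim: ps U => [|p ps IH] U /=; first by split=> [|[V -> //]]; exists U.
split=> [[V pV /IH[V' h1 h2]]|[V' [V pV h1] h2]]; first by exists V' => //; exists V.
by exists V => //; apply/IH; exists V'.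
Qed.

Section Sequence.

Variables m n : nat.

Lemma row_switching i j0 k U : good (key_le (done_before i j0)) U ->
  (exists V, switching_sequence [seq (i, j) | j <- iota j0 k] U V) /\
  (forall V, switching_sequence [seq (i, j) | j <- iota j0 k] U V ->
    good (key_le (done_before i (j0 + k))) V /\ same_content U V).
Proof.
elim: k j0 U => [|k IH] j0 U Ug /=.
  by rewrite addn0; split=> [|V ->]; [exists U | split].
split.
  have [|W pW] := @switching_process_exists i j0 U.
    apply: (good_inv _ _ _ Ug); [exact: key_le_anti | | exact: done_before_class].
    by rewrite /= /done_before; lia.
  have [Wg _] := good_step_before Ug pW.
  by have [[V sV] _] := IH _ _ Wg; exists V, W.
move=> V [W pW sW]; have [Wg [dW _ _ cW]] := good_step_before Ug pW.
have [Vg scV] := (IH _ _ Wg).2 V sW; rewrite addnS -addSn; split=> //.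
exact: same_content_trans scV.
Qed.

Lemma switching_orderS k : switching_order k.+1 n =
  [seq (k.+1, j) | j <- iota 1 n] ++ switching_order k n.
Proof. by rewrite /switching_order -(addn1 k) iotaD rev_cat /= add1n addn1. Qed.

Lemma all_switching k U : letters_within m n U -> good (key_le (done_before k 1)) U ->
  (exists V, switching_sequence (switching_order k n) U V) /\
  (forall V, switching_sequence (switching_order k n) U V ->
    good (key_le (done_before 0 1)) V /\ same_content U V).
Proof.
elim: k U => [|k IH] U Uw Ug; first by split=> [|V ->]; [exists U | split].
rewrite switching_orderS; have [[W sW] HW] := row_switching n Ug.
have step W' : switching_sequence [seq (k.+1, j) | j <- iota 1 n] U W' ->
    letters_within m n W' /\ good (key_le (done_before k 1)) W'.
  move=> sW'; have [Wg cW] := HW _ sW'; have Ww := same_content_within cW Uw; split=> //.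
  (* The row ends with [done_before k.+1 (1 + n)]. This agrees with [done_before k 1] because all
     T-letters are between 1 and n: the former needs the upper bound, the latter the lower one. *)
  apply: good_sub Wg _ => c d x y /Ww wx /Ww wy.
  by case: x wx => -[] [l p] /=; case: y wy => -[] [l' q] //=; rewrite /done_before; lia.
split.
  have [Ww Wg] := step _ sW; have [[V sV] _] := IH _ Ww Wg.
  by exists V; apply/switching_sequence_cat; exists W.
move=> V /switching_sequence_cat[W' sW' sV]; have [Ww Wg] := step _ sW'.
have [Vg scV] := (IH _ Ww Wg).2 V sV; split=> //.
exact: same_content_trans (HW _ sW').2 scV.
Qed.

End Sequence.

(* [is_SYT] without the condition on the shape. *)
Definition tableau (T : filling) : Prop :=
  (forall c x, T.[? c] = Some x -> in_X x) /\
  [/\ rows_weakly_increasing T, columns_weakly_increasing T,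
      columns_unprimed_once T & rows_primed_once T].

(* In terms of single boxes: T extends S, and both are tableaux. *)
Record nested (S T : filling) : Prop := Nested {
  nested_inner : tableau S;
  nested_outer : tableau T;
  nested_convex : convex (domf S `|` domf T);
  nested_le : forall c d, c \in domf T -> d \in domf S -> ~~ le_box c d
}.

(** * The initial labelled filling *)

Lemma le_box_refl c : le_box c c.
Proof. by rewrite /le_box !leqnn. Qed.

Lemma nested_disjoint S T c : nested S T -> c \in domf S -> c \in domf T -> False.
Proof. by move=> ST cS cT; have := nested_le ST cT cS; rewrite le_box_refl. Qed.

Lemma filling_some (T : filling) c x : T.[? c] = Some x -> c \in domf T.
Proof. by rewrite -fndSome => ->. Qed.

Lemma some_filling (T : filling) c : c \in domf T -> exists x, T.[? c] = Some x.
Proof. by rewrite -fndSome; case: (T.[? c]) => // x; exists x. Qed.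

Lemma letter_le_trans x y z : letter_le x y -> letter_le y z -> letter_le x z.
Proof.
by case: x y z => [k p] [l q] [m r]; rewrite /letter_le /=; case: p q r => -[] [] /=; lia.
Qed.

Lemma tableau_le (T : filling) (i j k l : nat) x y : tableau T -> (i, l) \in domf T ->
  T.[? (i, j)] = Some x -> T.[? (k, l)] = Some y -> i <= k -> j <= l -> letter_le x y.
Proof.
case=> _ [rT cT _ _] /some_filling[z Tz] Tx Ty ik jl.
exact: letter_le_trans (rT _ _ _ _ _ Tx Tz jl) (cT _ _ _ _ _ Tz Ty ik).
Qed.

Section Nested.

Variables S T : filling.
Hypothesis ST : nested S T.

(** The corner (i, l) joins the row of c to the column of d. Unlike (k, j) it always stays in the
    shifted plane, and it belongs to S because no box of T is north-west of d. *)
Lemma inner_le c d x y : S.[? c] = Some x -> S.[? d] = Some y -> le_box c d -> letter_le x y.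
Proof.
case: c d => i j [k l] Sx Sy /andP[/= ik jl]; apply: (tableau_le (nested_inner ST) _ Sx Sy ik jl).
have cS := filling_some Sx; have dS := filling_some Sy.
have [plane cvx] := nested_convex ST.
have : (i, l) \in domf S `|` domf T.
  apply: (cvx (i, j) (i, l) (k, l)); rewrite ?inE ?cS ?dS //.
  - by have := plane (i, j); rewrite !inE cS /in_plane /= => /(_ isT); lia.
  - by rewrite /le_box /= leqnn.
  - by rewrite /le_box /= leqnn ik.
rewrite inE => /orP[//|mT]; have := nested_le ST mT dS.
by rewrite /le_box /= ik leqnn.
Qed.

Lemma outer_le c d x y : T.[? c] = Some x -> T.[? d] = Some y -> le_box c d -> letter_le x y.
Proof.
case: c d => i j [k l] Tx Ty /andP[/= ik jl]; apply: (tableau_le (nested_outer ST) _ Tx Ty ik jl).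
have cT := filling_some Tx; have dT := filling_some Ty.
have [plane cvx] := nested_convex ST.
have : (i, l) \in domf S `|` domf T.
  apply: (cvx (i, j) (i, l) (k, l)); rewrite ?inE ?cT ?dT ?orbT //.
  - by have := plane (i, j); rewrite !inE cT orbT /in_plane /= => /(_ isT); lia.
  - by rewrite /le_box /= leqnn.
  - by rewrite /le_box /= leqnn ik.
rewrite inE => /orP[mS|//]; have := nested_le ST cT mS.
by rewrite /le_box /= jl leqnn.
Qed.

Lemma label_boxes_domf : domf (label_boxes S T) = domf S `|` domf T.
Proof. by rewrite /label_boxes domf_cat. Qed.

Lemma fnd_fmap_label (R : filling) (l : label) c :
  [fmap d : domf R => (l, R d)].[? c] = omap (pair l) R.[? c].
Proof.
have [cR|cR] := boolP (c \in domf R); last by rewrite !not_fnd.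
by rewrite (in_fnd cR) (in_fnd (f := [fmap d : domf R => (l, R d)]) cR) ffunE.
Qed.

Lemma label_boxesE c : (label_boxes S T).[? c] =
  if T.[? c] is Some y then Some (LabT, y) else omap (pair LabS) S.[? c].
Proof.
rewrite /label_boxes fnd_cat !fnd_fmap_label; case: ifP => [cT|/negbT cT].
  by have [y ->] := some_filling (T := T) cT.
by rewrite (not_fnd (f := T) cT).
Qed.

Lemma label_boxes_some c x : (label_boxes S T).[? c] = Some x ->
  if x.1 is LabS then S.[? c] = Some x.2 else T.[? c] = Some x.2.
Proof.
by rewrite label_boxesE; case: (T.[? c]) => [y [<-]|] //; case: (S.[? c]) => //= y [<-].
Qed.

Lemma max_entry_ge (R : filling) c x : R.[? c] = Some x -> x.1 <= max_entry R.
Proof.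
move=> Rc; have cR := filling_some Rc; move: Rc; rewrite (in_fnd cR) => -[<-].
exact: (leq_bigmax [` cR]).
Qed.

Lemma label_boxes_within :
  letters_within (max_entry S) (max_entry T) (label_boxes S T).
Proof.
move=> c [[] x] /label_boxes_some /= Rc; rewrite (max_entry_ge Rc) andbT.
  exact: (nested_inner ST).1 Rc.
exact: (nested_outer ST).1 Rc.
Qed.

Lemma label_boxes_good :
  good (key_le (done_before (max_entry S) 1)) (label_boxes S T).
Proof.
split.
- by rewrite label_boxes_domf; exact: nested_convex ST.
- move=> c d [lx x] [ly y] Ux Uy cd.
  have := label_boxes_within Ux; have := label_boxes_within Uy.
  move: Ux Uy => /label_boxes_some Ux /label_boxes_some Uy; case: lx ly Ux Uy => -[] /= Rx Ry.
  + by have := inner_le Rx Ry cd; rewrite /letter_le; lia.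
  + by rewrite /done_before; lia.
  + by have := nested_le ST (filling_some Rx) (filling_some Ry); rewrite cd.
  + by have := outer_le Rx Ry cd; rewrite /letter_le; lia.
- move=> c d [[] x] [[] y] /label_boxes_some /= Rx /label_boxes_some /= Ry // [exy] cd.
  + by have := inner_le Rx Ry cd; rewrite /letter_le exy ltnn eqxx.
  + by have := outer_le Rx Ry cd; rewrite /letter_le exy ltnn eqxx.
- move=> i k j [[] [x p]] [[] [y q]] /label_boxes_some /= Rx /label_boxes_some /= Ry // [exy].
  + move=> /negbTE ep /negbTE eq; rewrite exy ep in Rx; rewrite eq in Ry.
    by case: (nested_inner ST) => _ [_ _ H _]; apply: H Rx Ry.
  + move=> /negbTE ep /negbTE eq; rewrite exy ep in Rx; rewrite eq in Ry.
    by case: (nested_outer ST) => _ [_ _ H _]; apply: H Rx Ry.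
- move=> i k j [[] [x p]] [[] [y q]] /label_boxes_some /= Rx /label_boxes_some /= Ry // [exy].
  + move=> ep eq; rewrite exy ep in Rx; rewrite eq in Ry.
    by case: (nested_inner ST) => _ [_ _ _ H]; apply: H Rx Ry.
  + move=> ep eq; rewrite exy ep in Rx; rewrite eq in Ry.
    by case: (nested_outer ST) => _ [_ _ _ H]; apply: H Rx Ry.
Qed.

End Nested.

(** * Reading off the two parts and their weights *)

Lemma S_partE U c : (S_part U).[? c] =
  if U.[? c] is Some (LabS, x) then Some x else None.
Proof.
rewrite /S_part fnd_reducef; have [cU|cU] := boolP (c \in domf U); last by rewrite !not_fnd.
by rewrite (in_fnd cU) in_fnd ffunE; case: (U _) => -[].
Qed.

Lemma T_partE U c : (T_part U).[? c] =
  if U.[? c] is Some (LabT, x) then Some x else None.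
Proof.
rewrite /T_part fnd_reducef; have [cU|cU] := boolP (c \in domf U); last by rewrite !not_fnd.
by rewrite (in_fnd cU) in_fnd ffunE; case: (U _) => -[].
Qed.

Lemma S_part_some U c x : (S_part U).[? c] = Some x <-> U.[? c] = Some (LabS, x).
Proof.
by rewrite S_partE; split=> [|-> //]; case: (U.[? c]) => // -[[] y] // [<-].
Qed.

Lemma T_part_some U c x : (T_part U).[? c] = Some x <-> U.[? c] = Some (LabT, x).
Proof.
by rewrite T_partE; split=> [|-> //]; case: (U.[? c]) => // -[[] y] // [<-].
Qed.

Lemma parts_domf U : domf (T_part U) `|` domf (S_part U) = domf U.
Proof.
apply/fsetP => c; rewrite in_fsetU -!fndSome T_partE S_partE.
by case: (U.[? c]) => // -[[] x].
Qed.

Lemma tableau_part (le : rel (bool * nat)) (U : labelled) (l : label) (R : filling) :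
  good le U -> (forall c x, R.[? c] = Some x -> U.[? c] = Some (l, x)) ->
  (forall c x, R.[? c] = Some x -> in_X x) ->
  (forall k k', le (if l is LabS then true else false, k)
                  (if l is LabS then true else false, k') -> k <= k') ->
  tableau R.
Proof.
move=> Ug RU RX leP'; split=> //.
have mono c d x y : R.[? c] = Some x -> R.[? d] = Some y -> le_box c d -> letter_le x y.
  move=> /RU Rx /RU Ry cd; rewrite /letter_le; have := leP' _ _ (good_le Ug Rx Ry cd).
  case: (ltngtP x.1 y.1) => //= exy _; apply: (good_ord Ug Rx Ry _ cd).
  by rewrite /key_of /= exy.
split.
- by move=> i j j' x y Rx Ry jj; apply: mono Rx Ry _; rewrite /le_box /= leqnn.
- by move=> i i' j x y Rx Ry ii; apply: mono Rx Ry _; rewrite /le_box /= leqnn ii.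
- by move=> k i i' j /RU Rx /RU Ry; apply: (good_col Ug Rx Ry).
- by move=> k i j j' /RU Rx /RU Ry; apply: (good_row Ug Rx Ry).
Qed.

Definition count_entries (D : {fset box}) (T : filling) k :=
  \sum_(c <- D) (omap fst T.[? c] == Some k).

(** A common index set [D] makes the weights of fillings with different domains comparable. *)
Lemma wtE (D : {fset box}) (T : filling) k : domf T `<=` D -> wt T k = count_entries D T k.
Proof.
move=> TD; rewrite /count_entries -(big_fset_incl _ TD); last first.
  by move=> c _ /not_fnd ->.
rewrite big_seq_fsetE /wt -sum1_card big_mkcond /=; apply: eq_bigr => c _.
by rewrite inE -Some_fnd /=; case: eqP => [->|]; rewrite ?eqxx //; case: eqP => // -[].
Qed.

Lemma component_spec S T R : nested S T -> component_switching S T R ->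
  [/\ nested R.1 R.2, domf R.1 `|` domf R.2 = domf S `|` domf T,
      wt R.2 =1 wt S & wt R.1 =1 wt T].
Proof.
move=> ST [V sV eR]; have [-> ->] : R.1 = T_part V /\ R.2 = S_part V by rewrite eR.
have [Vg [dV cV]] := (all_switching (label_boxes_within ST) (label_boxes_good ST)).2 V sV.
have dV' : domf V = domf S `|` domf T by rewrite dV label_boxes_domf.
have Vw := same_content_within (conj dV cV) (label_boxes_within ST).
split.
- split.
  + apply: (tableau_part (l := LabT) Vg) => [c x /T_part_some|c x /T_part_some /Vw /andP[]|] //.
  + apply: (tableau_part (l := LabS) Vg) => [c x /S_part_some|c x /S_part_some /Vw /andP[]|] //.
  + by rewrite parts_domf; apply: good_convex Vg.
  + move=> c d /some_filling[x /S_part_some Vc] /some_filling[y /T_part_some Vd].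
    apply/negP => /(good_le Vg Vc Vd) /=; rewrite /done_before.
    by have := Vw _ _ Vc; rewrite /=; lia.
- by rewrite parts_domf dV'.
- move=> k; have -> : wt (S_part V) k = count_entries (domf V) (S_part V) k.
    by apply: wtE; rewrite -parts_domf fsubsetUr.
  have -> : wt S k = count_entries (domf V) S k by apply: wtE; rewrite dV' fsubsetUl.
  transitivity (count_key V (true, k)).
    rewrite /count_key; apply: eq_bigr => c _; rewrite S_partE /keyat.
    by case: (V.[? c]) => // -[[] x].
  rewrite cV /count_key -dV; apply: eq_bigr => c _; rewrite /keyat label_boxesE.
  case Tc: (T.[? c]) => [y|]; case Sc: (S.[? c]) => [x|] //=.
  by case: (nested_disjoint ST (filling_some Sc) (filling_some Tc)).
- move=> k; have -> : wt (T_part V) k = count_entries (domf V) (T_part V) k.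
    by apply: wtE; rewrite -parts_domf fsubsetUl.
  have -> : wt T k = count_entries (domf V) T k by apply: wtE; rewrite dV' fsubsetUr.
  transitivity (count_key V (false, k)).
    rewrite /count_key; apply: eq_bigr => c _; rewrite T_partE /keyat.
    by case: (V.[? c]) => // -[[] x].
  rewrite cV /count_key -dV; apply: eq_bigr => c _; rewrite /keyat label_boxesE.
  by case Tc: (T.[? c]) => [y|]; case Sc: (S.[? c]) => [x|] //=.
Qed.

Lemma component_switching_exists S T : nested S T ->
  exists R, component_switching S T R.
Proof.
move=> ST; have [[V sV] _] := all_switching (label_boxes_within ST) (label_boxes_good ST).
by exists (T_part V, S_part V); exists V.
Qed.

(** * From strict partitions to convex sets and back *)

Lemma le_box_trans c d e : le_box c d -> le_box d e -> le_box c e.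
Proof. by rewrite /le_box; lia. Qed.

Definition down_closed (I : pred box) := forall c d, in_plane c -> le_box c d -> I d -> I c.

Lemma initial_segment (Q : pred nat) n : (forall k, Q k.+1 -> Q k) -> ~~ Q n ->
  exists m, forall k, Q k = (k < m).
Proof.
move=> Qd Qn; have Qle k l : k <= l -> Q l -> Q k.
  by move=> /subnKC <-; elim: (l - k) => [|r IH]; rewrite ?addn0 // addnS => /Qd.
have ex : exists k, ~~ Q k by exists n.
exists (ex_minn ex) => k; case: ex_minnP => m nQm mmin.
have [lt|le] := ltnP k m; first by apply: contraLR lt => /mmin; rewrite leqNgt.
by apply: contraNF nQm; apply: Qle.
Qed.

(** Each row of such a set is an initial segment from the diagonal on, and so is the set of its
    diagonal boxes; the row lengths are the parts. *)
Lemma down_closed_shape (I : pred box) n :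
  (forall c, I c -> in_plane c /\ c.1 <= n /\ c.2 <= n) -> down_closed I ->
  exists2 la, strict_partition la & shifted_shape la =i I.
Proof.
move=> Ib Id.
have row i : exists m, (1 <= i -> forall k, I (i, i + k) = (k < m)) /\ (i = 0 -> m = 0).
  case: i => [|i]; first by exists 0.
  have [k|/=|m Hm] := @initial_segment (fun k => I (i.+1, i.+1 + k)) n.
  - by apply: Id; rewrite /in_plane /le_box /=; lia.
  - by apply/negP => /Ib /=; lia.
  by exists m; split=> // _ k; rewrite -Hm.
have [len Hlen] : exists len, forall i, 1 <= i -> forall k, I (i, i + k) = (k < len i).
  (* [row] asserts a length for each row separately; searching for the first missing box turns it
     into a function. The search succeeds because the length is at most n. *)
  exists (fun i => find (fun k => ~~ I (i, i + k)) (iota 0 n.+1)) => i i0 k.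
  have [m [/(_ i0) Hm _]] := row i; rewrite Hm.
  have mn : m <= n.
    by rewrite leqNgt -Hm; apply/negP => /Ib /=; lia.
  congr (_ < _); have hs : has (fun k => ~~ I (i, i + k)) (iota 0 n.+1).
    by apply/hasP; exists m; rewrite ?Hm ?ltnn // mem_iota; lia.
  set r := find _ _; have rlt : r < n.+1 by rewrite -(size_iota 0 n.+1) -has_find.
  have := nth_find 0 hs; rewrite nth_iota // add0n Hm -leqNgt => mr.
  have [lt|ge] := ltnP m r; last by apply/eqP; rewrite eqn_leq mr ge.
  by have := before_find 0 lt; rewrite nth_iota ?(ltn_trans lt) // add0n Hm ltnn.
have [k|/=|L HL] := @initial_segment (fun k => I (k.+1, k.+1)) n.
- by apply: Id; rewrite /in_plane /le_box /=; lia.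
- by apply/negP => /Ib /=; lia.
pose la := [seq len i | i <- iota 1 L].
have nth_la r : r < L -> nth 0 la r = len r.+1.
  by move=> rL; rewrite (nth_map 0) ?size_iota // nth_iota // add1n.
have len_gt0 r : (0 < len r.+1) = (r < L).
  by rewrite -Hlen // addn0 HL.
exists la; first apply/andP; first split.
- apply/(sortedP 0) => r; rewrite size_map size_iota => rL.
  rewrite !nth_la ?(ltnW rL) //=; have := rL; rewrite -len_gt0.
  (* Above the last box of row r.+2, at offset k from the diagonal, lies a box of row r.+1 at offset
     k.+1, whence the strict decrease. *)
  case e : (len r.+2) => [|k] // _; have := Hlen r.+2 isT k; rewrite e ltnSn => Ik.
  rewrite /gtn /= -Hlen // addnS -addSn; apply: Id Ik; rewrite /in_plane /le_box /=; lia.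
- apply/mapP => -[i]; rewrite mem_iota => /andP[i1 iL] e.
  by have := len_gt0 i.-1; rewrite prednK // -e ltnn; lia.
move=> [i j]; rewrite inE /= size_map size_iota; apply/idP/idP.
  move=> /andP[/andP[i1 iL] /andP[ij]]; rewrite nth_la; last by lia.
  rewrite prednK // => jle; rewrite unfold_in /=.
  by rewrite -(subnKC ij) Hlen //; have := len_gt0 i.-1; rewrite prednK //; lia.
rewrite unfold_in => Iij; have [/andP[/= i1 ij] _] := Ib _ Iij.
have iL : i.-1 < L.
  by rewrite -HL prednK //; apply: Id Iij; rewrite /in_plane /le_box /=; lia.
rewrite i1 ij nth_la //= prednK //; have := Hlen i i1 (j - i); rewrite subnKC // Iij => /esym.
by move=> lt; apply/andP; split; lia.
Qed.

Lemma strict_partition_step la r : strict_partition la -> r.+1 < size la ->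
  nth 0 la r.+1 < nth 0 la r.
Proof. by case/andP => /(sortedP 0) H _ /H. Qed.

(** As the parts strictly decrease, the right ends of the rows move weakly west on the way down. *)
Lemma shifted_shape_down la : strict_partition la -> down_closed (shifted_shape la).
Proof.
move=> sp [i j] [k l] /andP[/= i1 ij] /andP[/= ik jl].
rewrite /shifted_shape /= => /andP[/andP[k1 ks] /andP[kl lle]].
have anti r s : r + s < size la -> nth 0 la (r + s) + s <= nth 0 la r.
  elim: s => [|s IH]; first by rewrite !addn0.
  rewrite addnS => lt; have := strict_partition_step sp lt; have := IH (ltnW lt); lia.
have := anti i.-1 (k - i); rewrite (_ : i.-1 + (k - i) = k.-1); last by lia.
by move=> /(_ ltac:(lia)) h; apply/andP; split; lia.
Qed.

Lemma shifted_shape_plane la c : shifted_shape la c -> in_plane c.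
Proof. by case/andP => /andP[h _] /andP[h' _]; rewrite /in_plane h. Qed.

Lemma skew_convex D la mu : strict_partition la -> strict_partition mu ->
  has_shape D la mu -> convex D.
Proof.
move=> sl sm DE; split=> [c|c d e]; rewrite !DE !inE.
  by case/andP => _ /shifted_shape_plane.
move=> /andP[cm cl] /andP[em el] pd cd de; apply/andP; split.
  by apply: contra cm; apply: shifted_shape_down cd => //; apply: shifted_shape_plane cl.
exact: shifted_shape_down de el.
Qed.

Lemma extends_nested S T : is_SYT S -> is_SYT T -> extends T S -> nested S T.
Proof.
move=> [_ tS] [_ tT] [la [mu [nu [[sl sm sn] [nm ml SE TE]]]]]; split=> //.
  apply: (skew_convex sl sn) => c; rewrite in_fsetU SE TE !inE.
  by have := nm c; have := ml c; rewrite !unfold_in /=; lia.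
move=> c d; rewrite SE TE !inE => /andP[cm cl] /andP[_ dm].
apply: contra cm => cd; apply: shifted_shape_down cd dm => //; exact: shifted_shape_plane cl.
Qed.

Lemma mem_predD (P Q : pred box) c : (c \in [predD P & Q]) = (c \notin Q) && (c \in P).
Proof. by []. Qed.

Definition generated (D : {fset box}) : pred box :=
  fun c => in_plane c && [exists d : D, le_box c (val d)].

Lemma generatedP (D : {fset box}) c :
  reflect (in_plane c /\ exists2 d, d \in D & le_box c d) (generated D c).
Proof.
apply: (iffP andP) => -[pc].
  by case/existsP => d cd; split=> //; exists (val d) => //; apply: valP.
by case=> d dD cd; split=> //; apply/existsP; exists [` dD].
Qed.

Lemma generated_sub D (I : pred box) : (forall c, I c -> generated D c) -> down_closed I ->
  exists2 la, strict_partition la & shifted_shape la =i I.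
Proof.
move=> ID Id; apply: (@down_closed_shape I (\max_(d : D) ((val d).1 + (val d).2))) => // c Ic.
have /generatedP[pc [d dD /andP[h1 h2]]] := ID _ Ic; split=> //.
have := leq_bigmax (F := fun d : D => (val d).1 + (val d).2) [` dD]; rewrite /=; lia.
Qed.

(** The outer partition is the order ideal generated by [D]; removing T, then all of [D], gives the
    other two. These stay down-closed: a box of the ideal south-east of a box of T is in [D] by
    convexity, hence in T by [nested_le]. *)
Lemma nested_extends S T : nested S T -> extends T S /\ is_SYT S /\ is_SYT T.
Proof.
move=> ST; have [plane cvx] := nested_convex ST; set D := domf S `|` domf T in plane cvx.
have genD c : c \in D -> generated D c.
  by move=> cD; apply/generatedP; split; [exact: plane | exists c => //; apply: le_box_refl].
have gen_down : down_closed (generated D).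
  move=> c d pc cd /generatedP[_ [e eD de]]; apply/generatedP; split=> //.
  by exists e => //; apply: le_box_trans de.
have [la sl laE] := generated_sub (fun c h => h) gen_down.
have [||mu sm muE] := @generated_sub D (fun c => generated D c && (c \notin domf T)).
- by move=> c /andP[].
- move=> c d pc cd /andP[gd dT]; apply/andP; split; first exact: gen_down gd.
  apply/negP => cT; have /generatedP[pd [e eD de]] := gd.
  have : d \in D by apply: (cvx c d e) => //; rewrite in_fsetU cT orbT.
  by rewrite in_fsetU (negbTE dT) orbF => dS; have := nested_le ST cT dS; rewrite cd.
have [||nu sn nuE] := @generated_sub D (fun c => generated D c && (c \notin D)).
- by move=> c /andP[].
- move=> c d pc cd /andP[gd dD]; apply/andP; split; first exact: gen_down gd.
  apply: contra dD => cD; have /generatedP[pd [e eD de]] := gd.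
  exact: (cvx c d e).
have {laE}laE c : (c \in shifted_shape la) = generated D c := laE c.
have {muE}muE c : (c \in shifted_shape mu) = generated D c && (c \notin domf T) := muE c.
have {nuE}nuE c : (c \in shifted_shape nu) = generated D c && (c \notin D) := nuE c.
have SE : has_shape (domf S) mu nu.
  move=> c; rewrite mem_predD muE nuE.
  move: (genD c) (@nested_disjoint _ _ c ST); rewrite /D in_fsetU.
  by case: (c \in domf S); case: (c \in domf T); case: generated => //= g dj;
    first [have := dj isT isT | have := g isT].
have TE : has_shape (domf T) la mu.
  move=> c; rewrite mem_predD laE muE.
  move: (genD c) (@nested_disjoint _ _ c ST); rewrite /D in_fsetU.
  by case: (c \in domf S); case: (c \in domf T); case: generated => //= g dj;
    first [have := dj isT isT | have := g isT].
have nm : part_sub nu mu.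
  by move=> c; rewrite nuE muE /D => /andP[-> /=]; rewrite in_fsetU negb_or => /andP[].
have ml : part_sub mu la by move=> c; rewrite muE laE => /andP[].
split; first by exists la, mu, nu.
split; first by split; [exists mu, nu | exact: nested_inner ST].
by split; [exists la, mu | exact: nested_outer ST].
Qed.

(** * Connected components *)

Section Components.

Variable D : {fset box}.

(** Total on boxes, with a dummy value outside [D], so that [components D] is an image and sums over
    [D] split along its fibers. *)
Definition comp_of (c : box) : {fset box} :=
  if insub c is Some x then component (x : D) else fset0.

Lemma comp_of_in c (cD : c \in D) : comp_of c = component [` cD].
Proof. by rewrite /comp_of insubT. Qed.

Lemma adjacent_sym : connect_sym (@adjacent D).
Proof. by apply: sym_connect_sym => c d; rewrite /adjacent /= orbC. Qed.

Lemma mem_component (x : D) c :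
  reflect (exists2 y : D, c = val y & connect (@adjacent D) x y) (c \in component x).
Proof.
rewrite /component; apply: (iffP (imfsetP _ _ _ _)) => -[y]; rewrite ?inE => h1 h2; first by exists y.
by exists y; rewrite ?inE.
Qed.

Lemma mem_comp_of c : c \in D -> c \in comp_of c.
Proof.
by move=> cD; rewrite (comp_of_in cD); apply/mem_component; exists [` cD].
Qed.

Lemma component_eq (x y : D) : connect (@adjacent D) x y -> component x = component y.
Proof.
move=> xy; apply/fsetP => c; apply/mem_component/mem_component => -[z -> xz]; exists z => //.
  by apply: connect_trans xz; rewrite adjacent_sym.
exact: connect_trans xz.
Qed.

Lemma componentsE : components D = [fset comp_of c | c in D].
Proof.
rewrite /components; apply/fsetP => C; apply/imfsetP/imfsetP => -[c cD ->].
  by exists (val c); [exact: valP | rewrite (comp_of_in (valP c)); congr component; apply: val_inj].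
by exists [` cD]; rewrite // (comp_of_in cD).
Qed.

Lemma comp_of_components c : c \in D -> comp_of c \in components D.
Proof. by move=> cD; rewrite componentsE; apply/imfsetP; exists c. Qed.

Lemma components_mem C c : C \in components D -> c \in C -> c \in D /\ C = comp_of c.
Proof.
rewrite componentsE => /imfsetP[d /= dD ->]; rewrite (comp_of_in dD) => /mem_component[y -> dy].
split; first exact: valP.
rewrite (comp_of_in (valP y)) (component_eq dy); congr component; exact: val_inj.
Qed.

Lemma components_subset C : C \in components D -> C `<=` D.
Proof. by move=> CC; apply/fsubsetP => c /(components_mem CC)[]. Qed.

(** The path going east and then south from c to d stays in the shifted plane, hence in [D]. *)
Lemma comp_of_le (c d : box) : convex D -> c \in D -> d \in D -> le_box c d -> comp_of c = comp_of d.
Proof.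
case=> plane cvx; move en : ((d.1 - c.1) + (d.2 - c.2)) => n.
elim: n c en => [|n IH] c en cD dD /andP[h1 h2].
  by congr comp_of; case: c d en h1 h2 {cD dD} => i j [k l] /= *; congr (_, _); lia.
have pc := plane _ cD; have pd := plane _ dD; rewrite /in_plane in pc pd.
have [e [ce ed pe adj dist]] : exists e, [/\ le_box c e, le_box e d, in_plane e,
    (e == east c) || (e == south c) & (d.1 - e.1) + (d.2 - e.2) = n].
  have [lt|ge] := ltnP c.2 d.2.
    by exists (east c); split; rewrite /le_box /in_plane ?eqxx //=; lia.
  by exists (south c); split; rewrite /le_box /in_plane ?eqxx ?orbT //=; lia.
have eD : e \in D by apply: (cvx c e d).
rewrite -(IH e) // (comp_of_in cD) (comp_of_in eD); apply: component_eq; apply: connect1.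
by rewrite /adjacent /= adj.
Qed.

End Components.

Section Restrict.

Variables S T : filling.
Hypothesis ST : nested S T.
Let D := domf S `|` domf T.

Lemma restrict_some (R : filling) C c x : R.[& C].[? c] = Some x -> R.[? c] = Some x.
Proof. by rewrite fnd_restrict; case: ifP. Qed.

Lemma tableau_restrict (R : filling) C : tableau R -> tableau R.[& C].
Proof.
case=> RX [r1 r2 r3 r4]; split; first by move=> c x /restrict_some; apply: RX.
split.
- by move=> i j j' x y /restrict_some h1 /restrict_some h2; apply: r1 h1 h2.
- by move=> i j j' x y /restrict_some h1 /restrict_some h2; apply: r2 h1 h2.
- by move=> k i j j' /restrict_some h1 /restrict_some h2; apply: r3 h1 h2.
- by move=> k i j j' /restrict_some h1 /restrict_some h2; apply: r4 h1 h2.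
Qed.

Lemma restrict_domf C : C `<=` D -> domf S.[& C] `|` domf T.[& C] = C.
Proof.
move=> CD; rewrite !domf_restrict -fsetIUr; apply/eqP.
by move: CD; rewrite /fsubset.
Qed.

Lemma nested_restrict C : C \in components D -> nested S.[& C] T.[& C].
Proof.
move=> CC; have CD := components_subset CC; have [plane cvx] := nested_convex ST.
split; rewrite ?restrict_domf //; try exact: tableau_restrict.
- exact: tableau_restrict (nested_inner ST).
- exact: tableau_restrict (nested_outer ST).
- split=> [c cC|c d e cC eC pd cd de]; first by apply: plane; apply: (fsubsetP CD).
  have [cD Cc] := components_mem CC cC; have [eD _] := components_mem CC eC.
  have dD : d \in D by apply: (cvx c d e).
  by rewrite Cc (comp_of_le (nested_convex ST) cD dD cd) mem_comp_of.
- move=> c d; rewrite !domf_restrict !in_fsetI => /andP[_ cT] /andP[_ dS].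
  exact: (nested_le ST cT dS).
Qed.

End Restrict.

Lemma wt_components (D : {fset box}) (R : filling) (G : {fset box} -> filling) k :
  domf R `<=` D ->
  (forall C c, C \in components D -> (G C).[? c] = if c \in C then R.[? c] else None) ->
  wt R k = \sum_(C <- components D) wt (G C) k.
Proof.
move=> RD GE; rewrite (wtE k RD) /count_entries componentsE.
rewrite (partition_big_imfset _ (comp_of D)) /=; apply: eq_big_seq => C; rewrite -componentsE => CC.
rewrite (wtE (D := D)); last first.
  apply/fsubsetP => c; rewrite -fndSome GE //; case: ifP => // cC _.
  exact: (fsubsetP (components_subset CC)).
rewrite big_mkcond /=; apply: eq_big_seq => c cD; rewrite GE //.
case: eqP => [<-|ne]; first by rewrite mem_comp_of.
by case: ifP => // /(components_mem CC)[_ e]; case: ne; rewrite e.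
Qed.

(** The outcome on each component is only known to exist; finiteness lets an induction select one
    for each. *)
Lemma fset_choice (I : choiceType) (R : Type) (r0 : R) (s : {fset I}) (P : I -> R -> Prop) :
  (forall i, i \in s -> exists r, P i r) -> exists F, forall i, i \in s -> P i (F i).
Proof.
suff H (t : seq I) : (forall i, i \in t -> exists r, P i r) ->
    exists F, forall i, i \in t -> P i (F i) by apply: H.
elim: t => [|i t IH] Ht; first by exists (fun=> r0).
have [|F HF] := IH; first by move=> j jt; apply: Ht; rewrite inE jt orbT.
have [r Pr] := Ht i (mem_head _ _); exists (fun j => if j == i then r else F j) => j.
by rewrite inE; case: eqP => [->|_] //= /HF.
Qed.

Definition glue (D : {fset box}) (G : {fset box} -> filling) : filling :=
  reducef [fmap c : D => (G (comp_of D (val c))).[? val c]].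

Lemma glueE (D : {fset box}) (G : {fset box} -> filling) (c : box) : (glue D G).[? c] = if c \in D then (G (comp_of D c)).[? c] else None.
Proof.
rewrite /glue fnd_reducef; case: ifP => [cD|/negbT cD]; last by rewrite not_fnd.
by rewrite (in_fnd (f := [fmap c : D => (G (comp_of D (val c))).[? val c]]) cD) ffunE.
Qed.

Lemma glue_union (D : {fset box}) (G : {fset box} -> filling) :
  (forall C c x, C \in components D -> (G C).[? c] = Some x -> c \in C) ->
  is_union (components D) G (glue D G).
Proof.
move=> GC c x; rewrite glueE; split.
  by case: ifP => // cD Gc; exists (comp_of D c) => //; apply: comp_of_components.
case=> C CC Gc; have [cD e] := components_mem CC (GC _ _ _ CC Gc).
by rewrite cD -e.
Qed.

(** * Gluing the switched components *)

Section Union.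

Variables (S T : filling) (F : {fset box} -> filling * filling) (T' S' : filling).
Let D := domf S `|` domf T.
Hypothesis ST : nested S T.
Hypothesis Fspec : forall C, C \in components D ->
  component_switching S.[& C] T.[& C] (F C).
Hypothesis T'_union : is_union (components D) (fun C => (F C).1) T'.
Hypothesis S'_union : is_union (components D) (fun C => (F C).2) S'.

Lemma part_spec C : C \in components D ->
  [/\ nested (F C).1 (F C).2, domf (F C).1 `|` domf (F C).2 = C,
      wt (F C).2 =1 wt S.[& C] & wt (F C).1 =1 wt T.[& C]].
Proof.
move=> CC; have [h1 h2 h3 h4] := component_spec (nested_restrict ST CC) (Fspec CC).
by split=> //; rewrite h2 restrict_domf // components_subset.
Qed.

Lemma part1_in C c x : C \in components D -> (F C).1.[? c] = Some x -> c \in C.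
Proof.
by move=> CC Fc; have [_ <- _ _] := part_spec CC; rewrite in_fsetU (filling_some Fc).
Qed.

Lemma part2_in C c x : C \in components D -> (F C).2.[? c] = Some x -> c \in C.
Proof.
by move=> CC Fc; have [_ <- _ _] := part_spec CC; rewrite in_fsetU (filling_some Fc) orbT.
Qed.

(** Distinct components are disjoint, so no other piece contributes a box inside [C]. *)
Lemma union_part (G : {fset box} -> filling) (R : filling) C c :
  is_union (components D) G R ->
  (forall C c x, C \in components D -> (G C).[? c] = Some x -> c \in C) ->
  C \in components D -> (G C).[? c] = if c \in C then R.[? c] else None.
Proof.
move=> GR Gin CC; case: ifP => [cC|nC]; last first.
  by case Gc: ((G C).[? c]) => [x|] //; have := Gin _ _ _ CC Gc; rewrite nC.
case Gc: ((G C).[? c]) => [x|]; first by have /GR -> : exists2 C, C \in components D & (G C).[? c] = Some x by exists C.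
case Rc: (R.[? c]) => [x|] //; have [C' CC' Gc'] := (GR _ _).1 Rc.
have [_ e'] := components_mem CC' (Gin _ _ _ CC' Gc'); have [_ e] := components_mem CC cC.
by rewrite -Gc -Gc' e e'.
Qed.

Lemma union_in (G : {fset box} -> filling) (R : filling) c x :
  is_union (components D) G R ->
  (forall C c x, C \in components D -> (G C).[? c] = Some x -> c \in C) ->
  R.[? c] = Some x -> c \in D /\ (G (comp_of D c)).[? c] = Some x.
Proof.
move=> GR Gin /GR[C CC Gc]; have [cD e] := components_mem CC (Gin _ _ _ CC Gc).
by rewrite -e.
Qed.

(** Apart from positivity, each condition compares two boxes of one row or column; these are
    comparable for [le_box], hence in one component. *)
Lemma tableau_union (G : {fset box} -> filling) (R : filling) :
  is_union (components D) G R ->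
  (forall C c x, C \in components D -> (G C).[? c] = Some x -> c \in C) ->
  (forall C, C \in components D -> tableau (G C)) -> tableau R.
Proof.
move=> GR Gin Gt; have cv := nested_convex ST.
have Rin c x := union_in (c := c) (x := x) GR Gin.
have comparable c d x y : R.[? c] = Some x -> R.[? d] = Some y -> le_box c d ->
    exists2 C, C \in components D & (G C).[? c] = Some x /\ (G C).[? d] = Some y.
  move=> /Rin[cD Gc] /Rin[dD Gd] cd; exists (comp_of D c); first exact: comp_of_components.
  by split=> //; rewrite (comp_of_le cv cD dD cd).
split.
  move=> c x /Rin[cD Gc]; exact: (Gt _ (comp_of_components cD)).1 Gc.
split.
- move=> i j j' x y Rx Ry jj; have [|C CC [Gx Gy]] := comparable _ _ _ _ Rx Ry.
    by rewrite /le_box /= leqnn.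
  by have [_ [H _ _ _]] := Gt _ CC; apply: H Gx Gy jj.
- move=> i i' j x y Rx Ry ii; have [|C CC [Gx Gy]] := comparable _ _ _ _ Rx Ry.
    by rewrite /le_box /= leqnn ii.
  by have [_ [_ H _ _]] := Gt _ CC; apply: H Gx Gy ii.
- move=> k i i' j; wlog ii : i i' / i <= i'.
    move=> W Rx Ry; have [le|/ltnW le] := leqP i i'; first exact: (W _ _ le Rx Ry).
    by rewrite (W _ _ le Ry Rx).
  move=> Rx Ry; have [|C CC [Gx Gy]] := comparable _ _ _ _ Rx Ry.
    by rewrite /le_box /= leqnn ii.
  by have [_ [_ _ H _]] := Gt _ CC; apply: H Gx Gy.
- move=> k i j j'; wlog jj : j j' / j <= j'.
    move=> W Rx Ry; have [le|/ltnW le] := leqP j j'; first exact: (W _ _ le Rx Ry).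
    by rewrite (W _ _ le Ry Rx).
  move=> Rx Ry; have [|C CC [Gx Gy]] := comparable _ _ _ _ Rx Ry.
    by rewrite /le_box /= leqnn.
  by have [_ [_ _ _ H]] := Gt _ CC; apply: H Gx Gy.
Qed.

Lemma union_domf : domf T' `|` domf S' = D.
Proof.
apply/fsetP => c; rewrite in_fsetU; apply/orP/idP.
  case=> /some_filling[x].
    by case/(union_in T'_union part1_in).
  by case/(union_in S'_union part2_in).
move=> cD; have CC := comp_of_components cD; have [_ e _ _] := part_spec CC.
have := mem_comp_of cD; rewrite -e in_fsetU => /orP[] /some_filling[x Fx]; [left | right].
  by apply: (@filling_some _ _ x); apply/T'_union; exists (comp_of D c).
by apply: (@filling_some _ _ x); apply/S'_union; exists (comp_of D c).
Qed.

Lemma union_nested : nested T' S'.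
Proof.
split.
- by apply: (tableau_union T'_union part1_in) => C /part_spec[[]].
- by apply: (tableau_union S'_union part2_in) => C /part_spec[[]].
- by rewrite union_domf; apply: nested_convex ST.
- move=> c d /some_filling[x /(union_in S'_union part2_in)[cD Fc]].
  move=> /some_filling[y /(union_in T'_union part1_in)[dD Fd]].
  apply/negP => cd; have CC := comp_of_components cD; have [N _ _ _] := part_spec CC.
  have e := comp_of_le (nested_convex ST) cD dD cd; rewrite -e in Fd.
  by have := nested_le N (filling_some Fc) (filling_some Fd); rewrite cd.
Qed.

Lemma union_wt : wt S' =1 wt S /\ wt T' =1 wt T.
Proof.
have restr (R : filling) C c : R.[& C].[? c] = if c \in C then R.[? c] else None.
  exact: fnd_restrict.
split=> k.
  rewrite (@wt_components D S' (fun C => (F C).2)); last first.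
  - by move=> C c CC; apply: (union_part c S'_union part2_in CC).
  - by rewrite -union_domf fsubsetUr.
  rewrite (@wt_components D S (fun C => S.[& C])) //; last exact: fsubsetUl.
  by apply: eq_big_seq => C /part_spec[].
rewrite (@wt_components D T' (fun C => (F C).1)); last first.
- by move=> C c CC; apply: (union_part c T'_union part1_in CC).
- by rewrite -union_domf fsubsetUl.
rewrite (@wt_components D T (fun C => T.[& C])) //; last exact: fsubsetUr.
by apply: eq_big_seq => C /part_spec[].
Qed.

End Union.

Lemma tableau_switching_exists S T : nested S T ->
  exists T' S', tableau_switching S T (T', S').
Proof.
move=> ST; set D := domf S `|` domf T.
have [|F HF] := @fset_choice _ _ ([fmap], [fmap]) (components D)
    (fun C R => component_switching S.[& C] T.[& C] R).
  by move=> C CC; apply: component_switching_exists (nested_restrict ST CC).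
exists (glue D (fun C => (F C).1)), (glue D (fun C => (F C).2)), F; split=> //; split.
  by apply: glue_union => C c x; apply: (part1_in ST HF).
by apply: glue_union => C c x; apply: (part2_in ST HF).
Qed.

Theorem theorem3p9 (S T : filling) (hS : is_SYT S) (hT : is_SYT T)
    (hST : extends T S) :
  (exists ST S_T : filling, tableau_switching S T (ST, S_T)) /\
  (forall ST S_T : filling, tableau_switching S T (ST, S_T) ->
    (* (a) *)
    [/\ domf ST `|` domf S_T = domf S `|` domf T,
        wt S_T =1 wt S & wt ST =1 wt T] /\
    (* (b) *)
    [/\ extends S_T ST, is_SYT S_T & is_SYT ST]).
Proof.
have N := extends_nested hS hT hST; split; first exact: tableau_switching_exists.
move=> T' S' [F [HF [hT' hS']]].
have [w1 w2] := union_wt N HF hT' hS'.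
have [e [t1 t2]] := nested_extends (union_nested N HF hT' hS').
by split; split=> //; apply: union_domf N HF hT' hS'.
Qed.
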